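(* Let $f:\mathbb{D}\to\mathbb{C}$ and $g:\mathbb{D}\to\mathbb{R}$ be smooth and let the closed equation $\dot\alpha=\mathrm{i}\left(f(\alpha)\alpha^2+g(\alpha)\alpha+\overline{f(\alpha)}\right)$ possess a unique stable fixed point $\alpha_0\in\mathbb{D}$ for which $f(\alpha_0)\ne0$. For the continuum $\mathcal{M}_\delta=\bigcup_{\boldsymbol\lambda\in\overline V_\delta(\boldsymbol\lambda^* )}\mathcal{C}_{\boldsymbol\lambda}$ of periodic orbits (described in the context) of the system $$\dot\alpha = \mathrm{i}\left(f(Z)\alpha^2+g(Z)\alpha+\overline{f(Z)}\right),\qquad \dot\psi = f(Z)\alpha+g(Z)+\overline{f(Z)}\,\bar\alpha,\qquad \dot{\boldsymbol\lambda}=\boldsymbol 0,$$ the periodic solution $(\alpha(t),\psi(t),\boldsymbol\lambda^* )$ of this system with periodic orbit $\mathcal{C}_{\boldsymbol\lambda^*}\subset\mathcal{L}_{\boldsymbol\lambda^*}$ yields a splay state $\boldsymbol\phi(t)$ of $$\dot\phi_j=f(Z)e^{\mathrm{i}\phi_j}+g(Z)+\overline{f(Z)}e^{-\mathrm{i}\phi_j},\quad j=1,\dots,N,\qquad Z=\frac1N\sum_{j=1}^N e^{\mathrm{i}\phi_j}.$$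
   Context: Notation: $N\ge4$, $\mathbb{D}=\{z\in\mathbb{C}:|z|<1\}$, $\mathbb{S}^1=\mathbb{R}/2\pi\mathbb{Z}$, $\mathbb{T}^N=(\mathbb{S}^1)^N$. $\mathbb{T}^N_{\mathrm{ordered}}$ is the set of $\boldsymbol\theta\in\mathbb{T}^N$ with real representatives satisfying $\theta_1<\dots<\theta_N<\theta_1+2\pi$. $V=\{\boldsymbol\lambda\in(0,1)^{N-3}: 1>\lambda_1>\dots>\lambda_{N-3}>0\}$. $\overline V_\delta(\boldsymbol\lambda^* )$ denotes a closed $\delta$-neighborhood of $\boldsymbol\lambda^*$ in $V$ (Euclidean norm). Cross-ratio map $\boldsymbol\Lambda=(\Lambda_1,\dots,\Lambda_{N-3}):\mathbb{T}^N_{\mathrm{ordered}}\to V$, $$\Lambda_k(\boldsymbol\theta)=\frac{(e^{\mathrm{i}\theta_1}-e^{\mathrm{i}\theta_{k+3}})(e^{\mathrm{i}\theta_2}-e^{\mathrm{i}\theta_3})}{(e^{\mathrm{i}\theta_2}-e^{\mathrm{i}\theta_{k+3}})(e^{\mathrm{i}\theta_1}-e^{\mathrm{i}\theta_3})}.$$ Level sets: $\mathcal{L}_{\boldsymbol\lambda}=\{\boldsymbol\theta\in\mathbb{T}^N_{\mathrm{ordered}}:\boldsymbol\Lambda(\boldsymbol\theta)=\boldsymbol\lambda\}$. The distinguished point is $\boldsymbol\lambda^*=\boldsymbol\Lambda(\boldsymbol\theta^* )$, where $\theta^*_j=-\pi+\frac{2\pi}{N}(j-1)$. For $(\alpha,\psi)\in\mathbb{D}\times\mathbb{S}^1$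 let $G_{\alpha,\psi}(z)=\frac{\alpha+e^{\mathrm{i}\psi}z}{1+\bar\alpha e^{\mathrm{i}\psi}z}$. The reference map $\boldsymbol\Theta:V\to\mathbb{T}^N_{\mathrm{ordered}}$ is $\Theta_k(\boldsymbol\lambda)=-\pi+\frac{2\pi}{N}(k-1)$ for $k=1,2,3$ and, with $\zeta=e^{2\pi\mathrm{i}/N}$, $$\Theta_k(\boldsymbol\lambda)=-\mathrm{i}\,\mathrm{Log}\,\frac{\zeta(\lambda_{k-3}+\lambda_{k-3}\zeta-1)}{-\lambda_{k-3}+(1-\lambda_{k-3})\zeta},\quad k=4,\dots,N$$ (so $\boldsymbol\Theta(\boldsymbol\lambda^* )=\boldsymbol\theta^*$). The coordinates $(\alpha,\psi,\boldsymbol\lambda)$ of $\boldsymbol\phi\in\mathbb{T}^N_{\mathrm{ordered}}$ are defined by $e^{\mathrm{i}\phi_j}=G_{\alpha,\psi}(e^{\mathrm{i}\Theta_j(\boldsymbol\lambda)})$, $j=1,\dots,N$; this is a diffeomorphism $\mathbb{D}\times\mathbb{S}^1\times V\to\mathbb{T}^N_{\mathrm{ordered}}$, by which the two spaces are identified. In these coordinates $Z(\alpha,\psi,\boldsymbol\lambda)=\frac1N\sum_{j=1}^N G_{\alpha,\psi}(e^{\mathrm{i}\Theta_j(\boldsymbol\lambda)})$, and the system for $\boldsymbol\phi$ becomes the system for $(\alpha,\psi,\boldsymbol\lambda)$ in the claim. The continuum: a preceding theorem of the paper asserts that, under the stated hypotheses on $f$, $g$ and $\alpha_0$, there exists a $\delta$-neighborhood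 $\overline V_\delta(\boldsymbol\lambda^* )$ of $\boldsymbol\lambda^*$ such that for sufficiently large $N$ and every $\boldsymbol\lambda\in\overline V_\delta(\boldsymbol\lambda^* )$ there exists a unique periodic orbit $\mathcal{C}_{\boldsymbol\lambda}\subset\mathcal{L}_{\boldsymbol\lambda}$ of the system which is exponentially stable in $\mathcal{L}_{\boldsymbol\lambda}$, and that the union $\mathcal{M}_\delta=\bigcup_{\boldsymbol\lambda\in\overline V_\delta(\boldsymbol\lambda^* )}\mathcal{C}_{\boldsymbol\lambda}\subset\mathbb{T}^N_{\mathrm{ordered}}$ forms a compact normally attracting invariant manifold of dimension $N-2$ with invariant boundary. The proposition concerns these orbits and this $\mathcal{M}_\delta$. Splay state: a $T$-periodic solution $\boldsymbol\phi(t)$ for which there exists a $T$-periodic function $\varphi:\mathbb{R}\to\mathbb{S}^1$ such that $\phi_j(t)=\varphi(t+jT/N)$ holds for $j=1,\dots,N$. Normally attracting invariant manifold: let $r\ge1$, and let $\Phi^t$ be the flow of a $C^r$ vector field on the phase space $X$ (here $X=\mathbb{T}^N_{\mathrm{ordered}}$). A $C^r$-submanifold $\mathcal{M}\subset X$ is normally attracting invariant if (i) $\Phi^t(\mathcal{M})=\mathcal{M}$ for all $t\in\mathbb{R}$; (ii) there is a continuous splitting $T_{\mathcal{M}}X=T\mathcal{M}\oplus\mathcal{N}$ with continuous projections, invariant under the linearized flow $D\Phi^t=D\Phi^t_{\mathcal{M}}\oplus D\Phi^t_{\mathcal{N}}$; (iii) there are real $a<rb\le0$ and $C>0$ with $\|D\Phi^t_{\mathcal{M}}(x)\nu\|\le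 Ce^{bt}\|\nu\|$ for all $t\le0$, $(x,\nu)\in T\mathcal{M}$, and $\|D\Phi^t_{\mathcal{N}}(x)\nu\|\le Ce^{at}\|\nu\|$ for all $t\ge0$, $(x,\nu)\in\mathcal{N}$. The manifold may have a boundary; ''invariant boundary'' means that the boundary is invariant under the flow. *)

(* Defs.v *)
From HB Require Import structures.
From mathcomp Require Import all_boot all_order all_algebra.
From mathcomp Require Import all_classical all_reals all_analysis.
From mathcomp Require Import complex.

Set Implicit Arguments.
Unset Strict Implicit.
Unset Printing Implicit Defensive.

Import Order.TTheory GRing.Theory Num.Theory.
Import numFieldNormedType.Exports.

Local Open Scope classical_set_scope.
Local Open Scope ring_scope.
Local Open Scope complex_scope.

(* real-valued parts, not the numClosedFieldType ones *)
Local Notation Re := complex.Re.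
Local Notation Im := complex.Im.

(* Conventions.
   - The number of oscillators is N = n.+4; indices are 0-based, so the phase
     theta_(k+1) of the literature is [ph theta k], and V lives in 'rV_n.+1.
   - S^1 = R/2piZ and T^N are handled through representatives: a point of T^N is
     a row vector up to [eqT], a subset of T^N is a subset of 'rV_N invariant
     under the translations by 2piZ^N, a differentiable (or continuous) curve in
     S^1 or T^N is given by a differentiable (or continuous) lift. *)

(** * Complex numbers, curves, smoothness *)

Section Complex.
Variable R : realType.

Definition expi (x : R) : R[i] := cos x +i* sin x.

Definition cabs (z : R[i]) : R := Num.sqrt (Re z ^+ 2 + Im z ^+ 2).

(* principal argument, with values in ]-pi, pi] *)
Definition Arg (z : R[i]) : R :=
  if 0 <= Im z then acos (Re z / cabs z) else - acos (Re z / cabs z).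

Definition Log (z : R[i]) : R[i] := ln (cabs z) +i* Arg z.

Definition disk : set R[i] := [set z | cabs z < 1].

Definition is_derivec (a : R -> R[i]) (t : R) (d : R[i]) : Prop :=
  is_derive t 1 (fun s => Re (a s)) (Re d) /\
  is_derive t 1 (fun s => Im (a s)) (Im d).

End Complex.

Fixpoint Ck (R : realType) (V W : normedModType R) (k : nat) (U : set V)
    (f : V -> W) : Prop :=
  if k is k'.+1 then
    (forall x, U x -> differentiable f x) /\
    (forall v, Ck k' U (fun x => 'D_v f x))
  else forall x, U x -> {for x, continuous f}.

Section Smooth.
Variable R : realType.

(* smoothness in the real sense, as a function of (Re z, Im z) *)
Definition smooth_on_disk (h : R[i] -> R) : Prop :=
  forall k, @Ck R (R * R)%type R k
    [set p | disk (p.1 +i* p.2)] (fun p => h (p.1 +i* p.2)).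

Definition smooth_on_diskc (h : R[i] -> R[i]) : Prop :=
  smooth_on_disk (fun z => Re (h z)) /\ smooth_on_disk (fun z => Im (h z)).

End Smooth.

(** * The closed equation *)

Section ClosedEquation.
Variables (R : realType) (f : R[i] -> R[i]) (g : R[i] -> R).

Definition closed_rhs (a : R[i]) : R[i] :=
  'i * (f a * a ^+ 2 + (g a)%:C * a + (f a)^*).

Definition closed_solution (I : set R) (a : R -> R[i]) : Prop :=
  forall t, I t -> disk (a t) /\ is_derivec a t (closed_rhs (a t)).

(* Lyapunov stability. Solutions on arbitrary intervals are considered because
   f and g may be unbounded near the unit circle; a solution that stays close to
   a fixed point extends to all positive times. *)
Definition lyapunov_stable (a0 : R[i]) : Prop :=
  forall e : R, 0 < e -> exists2 d : R, 0 < d &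
    forall (s1 s2 : R) (a : R -> R[i]), s1 < 0 -> 0 < s2 ->
      closed_solution `]s1, s2[ a -> cabs (a 0 - a0) < d ->
      forall t, 0 <= t < s2 -> cabs (a t - a0) < e.

Definition stable_fixed_point (a0 : R[i]) : Prop :=
  [/\ disk a0, closed_rhs a0 = 0 & lyapunov_stable a0].

End ClosedEquation.

(** * Phase space and coordinates *)

Section Torus.
Variable R : realType.

Definition eq2pi (x y : R) : Prop := exists m : int, x = y + 2 * pi * m%:~R.

Definition eqT (p : nat) (x y : 'rV[R]_p) : Prop :=
  forall j, eq2pi (x 0 j) (y 0 j).

(* Euclidean norm (the library norm on matrices is the max norm) *)
Definition enorm (p : nat) (v : 'rV[R]_p) : R :=
  Num.sqrt (\sum_(j < p) v 0 j ^+ 2).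

(* When A is invariant under 2piZ^p this is the distance in T^p. *)
Definition torus_dist (p : nat) (x : 'rV[R]_p) (A : set 'rV[R]_p) : R :=
  inf [set enorm (x - y) | y in A].

(* Compactness in T^p of a 2piZ^p-invariant set. *)
Definition compactT (p : nat) (A : set 'rV[R]_p) : Prop :=
  compact (A `&` [set x | forall j, - pi <= x 0 j <= pi]).

End Torus.

Section Coordinates.
Variables (R : realType) (n : nat).
Notation N := n.+4.

Definition ph (theta : 'rV[R]_N) (k : nat) : R := theta 0 (inord k).

Definition ordered : set 'rV[R]_N := [set theta | exists2 theta' : 'rV[R]_N,
  eqT theta theta' &
  (forall i j : 'I_N, (i < j)%N -> theta' 0 i < theta' 0 j) /\
  theta' 0 ord_max < theta' 0 ord0 + 2 * pi].

Definition V : set 'rV[R]_n.+1 := [set lam |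
  (forall k, 0 < lam 0 k < 1) /\
  (forall k l : 'I_n.+1, (k < l)%N -> lam 0 l < lam 0 k)].

Definition cross_ratio (theta : 'rV[R]_N) (k : 'I_n.+1) : R[i] :=
  let e j := expi (ph theta j) in
  ((e 0%N - e k.+3) * (e 1%N - e 2%N)) / ((e 1%N - e k.+3) * (e 0%N - e 2%N)).

(* The cross-ratio of points of the unit circle is real. *)
Definition Lambda (theta : 'rV[R]_N) : 'rV[R]_n.+1 :=
  \row_k Re (cross_ratio theta k).

Definition level (lam : 'rV[R]_n.+1) : set 'rV[R]_N :=
  [set theta | ordered theta /\ Lambda theta = lam].

Definition theta_star : 'rV[R]_N := \row_j (- pi + 2 * pi / N%:R * j%:R).

Definition lambda_star : 'rV[R]_n.+1 := Lambda theta_star.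

Definition Vbar (delta : R) : set 'rV[R]_n.+1 :=
  [set lam | V lam /\ enorm (lam - lambda_star) <= delta].

Definition mobius (a : R[i]) (psi : R) (z : R[i]) : R[i] :=
  (a + expi psi * z) / (1 + a^* * expi psi * z).

(* The argument of Log has modulus 1, so that - 'i * Log (...) is real. *)
Definition Theta (lam : 'rV[R]_n.+1) : 'rV[R]_N := \row_j
  if (j < 3)%N then - pi + 2 * pi / N%:R * j%:R
  else let zeta := expi (2 * pi / N%:R) in
       let l := (lam 0 (inord (j - 3)))%:C in
       Re (- 'i * Log (zeta * (l + l * zeta - 1) / (- l + (1 - l) * zeta))).

(* (a, psi, lam) are the coordinates of phi *)
Definition coordinates (a : R[i]) (psi : R) (lam : 'rV[R]_n.+1)
    (phi : 'rV[R]_N) : Prop :=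
  forall j, expi (phi 0 j) = mobius a psi (expi (Theta lam 0 j)).

Definition Zcoord (a : R[i]) (psi : R) (lam : 'rV[R]_n.+1) : R[i] :=
  N%:R^-1 * \sum_(j < N) mobius a psi (expi (Theta lam 0 j)).

Definition Zphase (phi : 'rV[R]_N) : R[i] :=
  N%:R^-1 * \sum_(j < N) expi (phi 0 j).

End Coordinates.

(** * The two systems *)

Section Systems.
Variables (R : realType) (n : nat) (f : R[i] -> R[i]) (g : R[i] -> R).
Notation N := n.+4.

(* psi is a real lift of the S^1-valued coordinate. *)
Definition reduced_solution (I : set R) (a : R -> R[i]) (psi : R -> R)
    (lam : R -> 'rV[R]_n.+1) : Prop :=
  forall t, I t ->
    let Z := Zcoord (a t) (psi t) (lam t) in
    [/\ disk (a t) /\ V (lam t),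
        is_derivec a t
          ('i * (f Z * a t ^+ 2 + (g Z)%:C * a t + (f Z)^*)),
        exists2 d : R, is_derive t 1 psi d &
          d%:C = f Z * a t + (g Z)%:C + (f Z)^* * (a t)^* &
        is_derive t 1 lam 0].

Definition phase_solution (phi : R -> 'rV[R]_N) : Prop :=
  forall (t : R) (j : 'I_N), exists2 d : R, is_derive t 1 (fun s => phi s 0 j) d &
    let Z := Zphase (phi t) in
    d%:C = f Z * expi (phi t 0 j) + (g Z)%:C + (f Z)^* * expi (- phi t 0 j).

(* T > 0 is a period, not necessarily the minimal one. *)
Definition splay_state (phi : R -> 'rV[R]_N) : Prop :=
  phase_solution phi /\
  exists T : R, [/\ 0 < T, forall t, eqT (phi (t + T)) (phi t) &
    exists2 s : R -> R, forall t, eq2pi (s (t + T)) (s t) &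
      forall t (j : 'I_N), eq2pi (phi t 0 j) (s (t + j.+1%:R * T / N%:R))].

(* Solutions of the reduced system, seen in T^N via the coordinates. *)
Definition trajectory (I : set R) (phi : R -> 'rV[R]_N) : Prop :=
  (forall t, I t -> {for t, continuous phi}) /\
  exists a psi lam, reduced_solution I a psi lam /\
    forall t, I t -> coordinates (a t) (psi t) (lam t) (phi t).

Definition flow_rel (t : R) (x y : 'rV[R]_N) : Prop :=
  exists s1 s2 : R, exists phi : R -> 'rV[R]_N,
    [/\ s1 < 0 < s2, s1 < t < s2, trajectory `]s1, s2[ phi,
        phi 0 = x & phi t = y].

(* The flow lifted to R^N (arbitrary value where it is not defined). *)
Definition flow (t : R) (x : 'rV[R]_N) : 'rV[R]_N := get (flow_rel t x).

Definition periodic_orbit (O : set 'rV[R]_N) : Prop :=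
  exists (T : R) (phi : R -> 'rV[R]_N),
    [/\ 0 < T, trajectory setT phi,
        forall t, eqT (phi (t + T)) (phi t),
        ~ (forall t, eqT (phi t) (phi 0)) &
        O = [set theta | exists t, eqT theta (phi t)]].

(* Exponential (orbital) stability of O within the invariant set L. *)
Definition exp_stable_in (L O : set 'rV[R]_N) : Prop :=
  exists eta K mu : R, [/\ 0 < eta, 0 < K, 0 < mu &
    forall x, L x -> torus_dist x O < eta ->
    forall t y, 0 <= t -> flow_rel t x y ->
      torus_dist y O <= K * expR (- mu * t) * torus_dist x O].

End Systems.

(** * Submanifolds with boundary and normal attraction *)

Section Manifold.
Variables (R : realType) (p : nat).
Implicit Types (M U W : set 'rV[R]_p.+1) (x v : 'rV[R]_p.+1).

(* m-dimensional closed half-space, 0 < m *)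
Definition half_slice (m : nat) : set 'rV[R]_p.+1 :=
  [set y | 0 <= y 0 ord0 /\ forall j : 'I_p.+1, (m <= j)%N -> y 0 j = 0].

(* C^r slice charts; interior points of M are those sent to y_0 > 0 *)
Definition slice_chart (r m : nat) M U (Psi : 'rV[R]_p.+1 -> 'rV[R]_p.+1) : Prop :=
  exists W Psi', [/\ open U /\ open W, Ck r U Psi /\ Ck r W Psi',
    forall u, U u -> W (Psi u) /\ Psi' (Psi u) = u,
    forall w, W w -> U (Psi' w) /\ Psi (Psi' w) = w &
    forall u, U u -> (M u <-> half_slice m (Psi u))].

Definition submanifold (r m : nat) M : Prop :=
  forall x, M x -> exists2 U, U x & exists Psi, slice_chart r m M U Psi.

Definition mboundary (r m : nat) M : set 'rV[R]_p.+1 :=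
  [set x | M x /\ exists U Psi,
    [/\ U x, slice_chart r m M U Psi & Psi x 0 ord0 = 0]].

(* At boundary points this is the full m-dimensional tangent space. *)
Definition tangent (r m : nat) M x v : Prop :=
  exists U Psi, [/\ U x, slice_chart r m M U Psi &
    forall j : 'I_p.+1, (m <= j)%N -> ('d Psi x v) 0 j = 0].

End Manifold.

Section NormallyAttracting.
Variables (R : realType) (n : nat) (f : R[i] -> R[i]) (g : R[i] -> R).
Notation N := n.+4.
Notation Phi := (@flow R n f g).

Definition flow_invariant (M : set 'rV[R]_N) : Prop :=
  (forall t x, M x -> exists y, flow_rel f g t x y) /\
  (forall t, [set Phi t x | x in M] = M).

(* P x is the projection onto the normal space N_x along the tangent space, so
   that T_x M and N_x are the kernel and the image of P x. *)
Definition normally_attracting (r m : nat) (M : set 'rV[R]_N) : Prop :=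
  [/\ M `<=` @ordered R n, submanifold r m M, flow_invariant M &
  exists P : 'rV[R]_N -> 'M[R]_N,
  [/\ {within M, continuous P} /\
      (forall x y, M x -> eqT x y -> P x = P y),
      forall x, M x -> P x *m P x = P x /\
        (forall v, tangent r m M x v <-> v *m P x = 0),
      forall t x, M x ->
        [/\ differentiable (Phi t) x,
            forall v, v *m P x = 0 -> 'd (Phi t) x v *m P (Phi t x) = 0 &
            forall v, v *m P x = v ->
              'd (Phi t) x v *m P (Phi t x) = 'd (Phi t) x v] &
      exists a b C : R, [/\ a < r%:R * b, r%:R * b <= 0, 0 < C,
        forall t x v, t <= 0 -> M x -> v *m P x = 0 ->
          enorm ('d (Phi t) x v) <= C * expR (b * t) * enorm v &
        forall t x v, 0 <= t -> M x -> v *m P x = v ->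
          enorm ('d (Phi t) x v) <= C * expR (a * t) * enorm v]]].

Definition stable_orbit_in_level (lam : 'rV[R]_n.+1) (O : set 'rV[R]_N) : Prop :=
  [/\ periodic_orbit f g O, O `<=` level lam & exp_stable_in f g (level lam) O].

Definition union_orbits (delta : R) (C : 'rV[R]_n.+1 -> set 'rV[R]_N) :
    set 'rV[R]_N := \bigcup_(lam in Vbar delta) C lam.

Definition continuum (delta : R) (C : 'rV[R]_n.+1 -> set 'rV[R]_N) : Prop :=
  [/\ 0 < delta,
      forall lam, Vbar delta lam -> unique (stable_orbit_in_level lam) (C lam),
      compactT (union_orbits delta C) &
      exists r : nat, [/\ (0 < r)%N,
        normally_attracting r n.+2 (union_orbits delta C) &
        flow_invariant (mboundary r n.+2 (union_orbits delta C))]].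

End NormallyAttracting.

(* Main.v *)
(* The rotation theta_j |-> theta_(j+1) permutes the indices of the phases, and
   since Theta(lambda* ) = theta* consists of equally spaced points it acts in the
   coordinates on the leaf lambda* as psi |-> psi + 2pi/N.  It therefore commutes
   with the dynamics and preserves the level set of lambda*, so it maps the orbit
   C_(lambda* ) to an exponentially stable periodic orbit of the same leaf; by
   uniqueness the orbit is invariant.  Hence the rotated solution starts at some
   point phi(tau) of the original one, with tau > 0 by periodicity, and uniqueness
   for the phase equations gives phi_(j+1)(t) = phi_j(t + tau).  Iterating, N tau is
   a period and phi is a splay state. *)
Require Import Defs.
From mathcomp Require Import all_boot all_order all_algebra.
From mathcomp Require Import all_classical all_reals all_analysis.
From mathcomp Require Import complex ring lra zify.

Set Implicit Arguments.
Unset Strict Implicit.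
Unset Printing Implicit Defensive.

Import Order.TTheory GRing.Theory Num.Theory.
Import numFieldNormedType.Exports.
Local Open Scope classical_set_scope.
Local Open Scope ring_scope.
Local Open Scope complex_scope.

Local Notation Re := complex.Re.
Local Notation Im := complex.Im.

(** * The unit circle, phases modulo 2 pi, and Möbius maps of the disk *)

Section UnitCircle.
Variable R : realType.
Implicit Types (x y : R) (z w a u : R[i]).

Lemma conj_pair x y : (x +i* y)^*%R = x -i* y.
Proof. by []. Qed.

Lemma expiD x y : expi (x + y) = expi x * expi y.
Proof. by rewrite /expi cosD sinD; simpc; congr (_ +i* _); ring. Qed.

Lemma expi0 : expi (0 : R) = 1.
Proof. by rewrite /expi cos0 sin0. Qed.

Lemma expiN x : expi (- x) = (expi x)^*%R.
Proof. by rewrite /expi cosN sinN. Qed.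

Lemma expi_conj x : expi x * (expi x)^*%R = 1.
Proof. by rewrite -expiN -expiD subrr expi0. Qed.

Lemma expi_neq0 x : expi x != 0.
Proof.
by apply: contraTneq isT => x0; have := expi_conj x; rewrite x0 mul0r => /eqP;
  rewrite eq_sym oner_eq0.
Qed.

Lemma expi_pi : expi (pi : R) = -1.
Proof. by apply/eqP; rewrite /expi cospi sinpi eq_complex /= oppr0 !eqxx. Qed.

Lemma expi2pi : expi (2 * pi : R) = 1.
Proof. by rewrite mulr_natl mulr2n expiD expi_pi mulrNN mulr1. Qed.

Lemma expi_mulrn x m : expi (x *+ m) = expi x ^+ m.
Proof.
by elim: m => [|m IH]; rewrite ?mulr0n ?expr0 ?expi0// mulrS expiD IH exprS.
Qed.

Lemma expi_eq2pi x y : eq2pi x y -> expi x = expi y.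
Proof.
case=> m ->; rewrite expiD.
suff -> : expi (2 * pi * m%:~R : R) = 1 by rewrite mulr1.
have H k : expi (2 * pi * (Posz k)%:~R : R) = 1.
  rewrite (_ : _ * _ = (2 * pi) *+ k) ?expi_mulrn ?expi2pi ?expr1n//.
  exact: mulr_natr.
case: m => m; first exact: H.
by rewrite NegzE rmorphN mulrN expiN H rmorph1.
Qed.

(** Cosine is injective on [[0, pi]]; an [x] above [pi] is reflected to [2 * pi - x], which would
    have to vanish. *)
Lemma expi_eq1 x : 0 <= x < 2 * pi -> expi x = 1 -> x = 0.
Proof.
case/andP=> x0 x2 [c1 s0].
have pi0 := pi_gt0 R.
have [xpi|xpi] := leP x pi.
  by apply: cos_inj; rewrite ?c1 ?cos0// in_itv/= ?lexx ?x0 ?xpi ?ltW.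
have y0 : cos (2 * pi - x) = cos 0.
  by rewrite cos0 mulr_natl addrC cosD2pi cosN.
have : 2 * pi - x = 0.
  apply: cos_inj y0; rewrite in_itv/= ?lexx ?(ltW pi0)//.
  by apply/andP; split; lra.
by lra.
Qed.

Lemma expi_inj_eq2pi x y : expi x = expi y -> eq2pi x y.
Proof.
move=> xy; set P : R := 2 * pi.
have P0 : 0 < P by rewrite mulr_gt0 ?pi_gt0.
(* Removing [m] full turns moves [x - y] into [[0, P[], where [expi_eq1] applies. *)
pose m := Num.floor ((x - y) / P).
exists m; rewrite -/P.
have /andP[m1 m2] : m%:~R <= (x - y) / P < (m + 1)%:~R by rewrite floor_itv.
have h : 0 <= x - y - P * m%:~R < P.
  move: m1 m2; rewrite ler_pdivlMr// ltr_pdivrMr// intrD mulrDl mul1r.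
  by rewrite (mulrC _ P) => m1 m2; apply/andP; split; lra.
have : x - y - P * m%:~R = 0.
  apply: expi_eq1 => //.
  rewrite (@expi_eq2pi _ (x - y)) ?expiD ?expiN ?xy ?expi_conj//.
  by exists (- m); rewrite rmorphN/= mulrN.
by move/eqP; rewrite subr_eq0 subr_eq => /eqP ->; rewrite addrC.
Qed.

Lemma eq2piE x y : eq2pi x y <-> expi x = expi y.
Proof. by split; [exact: expi_eq2pi|exact: expi_inj_eq2pi]. Qed.

Lemma eqTE p (x y : 'rV[R]_p) :
  eqT x y <-> forall j, expi (x 0 j) = expi (y 0 j).
Proof. by split=> h j; apply/eq2piE. Qed.

Lemma normc_cabs z : `|z| = (cabs z)%:C.
Proof. by rewrite normc_def. Qed.

Lemma cabsM z w : cabs (z * w) = cabs z * cabs w.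
Proof. by apply: complexI; rewrite rmorphM/= -!normc_cabs normrM. Qed.

Lemma cabsV z : cabs z^-1 = (cabs z)^-1.
Proof. by apply: complexI; rewrite fmorphV/= -!normc_cabs normfV. Qed.

Lemma cabs_expi x : cabs (expi x) = 1.
Proof. by rewrite /cabs/= cos2Dsin2 sqrtr1. Qed.

Lemma diskE z : disk z <-> `|z| < 1.
Proof. by rewrite normc_cabs -[1]/(1%:C) ltcR. Qed.

Lemma cabs_conj z : cabs z^*%R = cabs z.
Proof. by apply: complexI; rewrite -!normc_cabs norm_conjC. Qed.

Lemma disk_conjM_neq1 a : disk a -> 1 - a * a^*%R != 0.
Proof.
move=> /diskE a1; rewrite -normCK subr_eq0 gt_eqF//.
by rewrite expr_lt1.
Qed.

(** A zero would force the product of [z] and the conjugate of [a] to be -1, of modulus 1, whereas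
    its modulus is that of [a]. *)
Lemma mobius_den_neq0 a z : disk a -> cabs z = 1 -> 1 + a^*%R * z != 0.
Proof.
move=> /diskE a1 z1; apply: contraTneq a1 => h.
have -> : `|a| = 1.
  have : `|a^*%R * z| = 1 by rewrite -normrN -[RHS](normr1 R[i]) -(addr0_eq h) opprK.
  by rewrite normrM norm_conjC (normc_cabs z) z1 mulr1.
by rewrite ltxx.
Qed.

(** On the unit circle the sine of the arccosine of the real part is the absolute value of the
    imaginary part; the case distinction in [Arg] restores its sign. *)
Lemma expi_Arg z : cabs z = 1 -> expi (Arg z) = z.
Proof.
case: z => a b z1; rewrite /Arg z1/= divr1.
have ab : a ^+ 2 + b ^+ 2 = 1.
  have : cabs (a +i* b) ^+ 2 = 1 by rewrite z1 expr1n.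
  by rewrite /cabs sqr_sqrtr ?addr_ge0 ?sqr_ge0.
have a1 : -1 <= a <= 1.
  by rewrite -ler_norml -(@expr_le1 _ 2)// real_normK ?num_real//; nra.
have sb : Num.sqrt (1 - a ^+ 2) = `|b| by rewrite -sqrtr_sqr -ab addrAC subrr add0r.
case: ifPn => b0; first by rewrite /expi acosK ?in_itv// sin_acos// sb ger0_norm.
rewrite expiN /expi acosK ?in_itv// sin_acos// sb ler0_norm.
  by rewrite conj_pair opprK.
by rewrite ltW// ltNge.
Qed.

(** Rotating the reference points is the same as shifting [psi]; this is how cyclic relabelling will
    act in coordinates. *)
Lemma mobius_add_angle a x y z :
  mobius a (x + y) z = mobius a x (expi y * z).
Proof. by rewrite /mobius expiD !mulrA. Qed.

End UnitCircle.

(** * Cross-ratios and the reference configuration *)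

Section ReferencePoint.
Variables (R : realType) (n : nat).
Local Notation N := n.+4.
Implicit Types (lam : 'rV[R]_n.+1) (a : R[i]) (phi : 'rV[R]_N).

Definition step : R := 2 * pi / N%:R.
Local Notation zeta := (expi step).

Lemma step_gt0 : 0 < step.
Proof. by rewrite divr_gt0// mulr_gt0// pi_gt0. Qed.

Lemma step_mulrn : step *+ N = 2 * pi.
Proof. by rewrite -[step *+ N]mulr_natr /step divfK// pnatr_eq0. Qed.

Lemma zetaXN : zeta ^+ N = 1.
Proof. by rewrite -expi_mulrn step_mulrn expi2pi. Qed.

Lemma zetaX_neq1 k : (0 < k < N)%N -> zeta ^+ k != 1.
Proof.
move=> /andP[k0 kN]; rewrite -expi_mulrn; apply/eqP => /expi_eq1 h.
suff : step *+ k = 0 by move/eqP; rewrite mulrn_eq0 (gt_eqF step_gt0) orbF gtn_eqF.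
by apply: h; rewrite mulrn_wge0 ?(ltW step_gt0)//= -step_mulrn ltr_pMn2l ?step_gt0.
Qed.

Lemma zetaX_inj j k : (j < N)%N -> (k < N)%N -> zeta ^+ j = zeta ^+ k -> j = k.
Proof.
wlog jk : j k / (j <= k)%N.
  by move=> H jN kN jk; have [/H|/ltnW /H e] := leqP j k; [exact|exact/esym/e].
move=> jN kN e; apply/eqP; rewrite eqn_leq jk leqNgt; apply/negP => lt.
have kj : (0 < k - j < N)%N.
  by rewrite subn_gt0 lt (leq_ltn_trans (leq_subr _ _)).
have /eqP := zetaX_neq1 kj; apply; apply: (mulfI (expf_neq0 j (expi_neq0 step))).
by rewrite -exprD subnKC// mulr1 e.
Qed.

Lemma zeta_neq1 : zeta != 1.
Proof. by rewrite -[zeta]expr1 zetaX_neq1. Qed.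

Lemma zeta_neqN1 : 1 + zeta != 0.
Proof.
have : zeta ^+ 2 != 1 by rewrite zetaX_neq1.
by apply: contra; rewrite addrC addr_eq0 => /eqP ->; rewrite sqrrN expr1n.
Qed.

Lemma expi_theta_star (j : 'I_N) : expi (theta_star R n 0 j) = - zeta ^+ j.
Proof.
by rewrite mxE expiD expiN expi_pi rmorphN1 mulN1r -/step mulr_natr expi_mulrn.
Qed.

Lemma expi_Theta_lt3 lam (j : 'I_N) : (j < 3)%N ->
  expi (Theta lam 0 j) = - zeta ^+ j.
Proof. by move=> j3; rewrite -expi_theta_star !mxE j3. Qed.

(** Otherwise [(1 - l) * zeta] would be real, but its imaginary part is [1 - l] times the sine of an
    angle strictly between 0 and [pi]. *)
Lemma zeta_den_neq0 (l : R) : l < 1 -> - l%:C + (1 - l%:C) * zeta != 0.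
Proof.
move=> l1; apply/eqP => h; have h1 : (1 - l%:C) * zeta = l%:C.
  by apply/eqP; rewrite eq_sym -subr_eq0 -oppr_eq0 opprB addrC h.
have : Im ((1 - l%:C) * zeta) = 0 by rewrite h1.
have -> : 1 - l%:C = (1 - l)%:C by rewrite rmorphB.
rewrite /expi; simpc => /= /eqP; rewrite mulf_eq0 gt_eqF ?subr_gt0//= => /eqP s0.
have := @sin_gt0_pi R step; rewrite s0 ltxx => H; suff: false by []; apply: H.
rewrite step_gt0/= /step ltr_pdivrMr// mulrC ltr_pM2l ?pi_gt0//.
by rewrite ltr_nat.
Qed.

(** The numerator is [- zeta ^+ 2] times the conjugate of the denominator, so the quotient has
    modulus 1 and is recovered from its argument. *)
Lemma expi_Theta_ge3 lam (j : 'I_N) : (3 <= j)%N ->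
  let l := (lam 0 (inord (j - 3)))%:C in lam 0 (inord (j - 3)) < 1 ->
  expi (Theta lam 0 j) =
    zeta * (l + l * zeta - 1) / (- l + (1 - l) * zeta).
Proof.
move=> j3 l l1; rewrite !mxE ltnNge j3 /= -/step -/l.
set w := zeta * _ / _.
have den0 := zeta_den_neq0 l1; rewrite -/l in den0.
have -> : - 0 * ln (cabs w) - -1 * Arg w = Arg w by ring.
apply: expi_Arg; rewrite /w 2!cabsM cabs_expi mul1r cabsV.
have -> : l + l * zeta - 1 = - zeta * (- l + (1 - l) * zeta)^*%R.
  have lc : l^*%R = l by exact: conjc_real.
  rewrite rmorphD rmorphM rmorphB rmorphN rmorph1 /= lc.
  transitivity (zeta * l - (1 - l) * (zeta * zeta^*%R)); last by ring.
  by rewrite expi_conj; ring.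
rewrite cabsM -mulN1r cabsM cabs_expi cabs_conj.
have -> : cabs (-1 : R[i]) = 1 by apply: complexI; rewrite -normc_cabs normrN1.
rewrite !mul1r mulfV//; apply: contra den0 => /eqP.
by rewrite -normr_eq0 normc_cabs => ->.
Qed.

Definition cross (F : fieldType) (z0 z1 z2 z3 : F) : F :=
  ((z0 - z3) * (z1 - z2)) / ((z1 - z3) * (z0 - z2)).

(** Each difference [G z - G w] is [z - w] times a nonzero constant, divided by one factor per
    point. Every point occurs once above and once below in the cross-ratio, so all these factors
    cancel. *)
Lemma cross_mobius a (u z0 z1 z2 z3 : R[i]) : u != 0 -> disk a ->
  1 + a^*%R * u * z0 != 0 -> 1 + a^*%R * u * z1 != 0 ->
  1 + a^*%R * u * z2 != 0 -> 1 + a^*%R * u * z3 != 0 ->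
  z1 != z3 -> z0 != z2 ->
  let G z := (a + u * z) / (1 + a^*%R * u * z) in
  cross (G z0) (G z1) (G z2) (G z3) = cross z0 z1 z2 z3.
Proof.
move=> u0 da d0 d1 d2 d3 z13 z02 G.
have GB z w : 1 + a^*%R * u * z != 0 -> 1 + a^*%R * u * w != 0 ->
    G z - G w = u * (1 - a * a^*%R) * (z - w) /
      ((1 + a^*%R * u * z) * (1 + a^*%R * u * w)).
  by move=> dz dw; rewrite /G; field; rewrite dz dw.
have := disk_conjM_neq1 da; rewrite /cross !GB//.
move: (1 - a * a^*%R) => c c0.
rewrite -subr_eq0 in z13; rewrite -subr_eq0 in z02.
by field; rewrite u0 c0 z13 z02 d0 d1 d2 d3.
Qed.

(** The formula in [Theta] is the solution [w] of this cross-ratio equation, the other three points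
    being the fixed reference points. The two inequalities are those that [cross_mobius] asks
    for. *)
Lemma cross_Theta (z l : R[i]) : z != 0 -> z != 1 -> 1 + z != 0 ->
  - l + (1 - l) * z != 0 ->
  let w := z * (l + l * z - 1) / (- l + (1 - l) * z) in
  [/\ - z - w != 0, -1 + z ^+ 2 != 0 & cross (-1) (- z) (- z ^+ 2) w = l].
Proof.
move=> z0 z1 zN1 d w.
have h1 : - z - w = z * (1 - z) / (- l + (1 - l) * z) by rewrite /w; field.
have h2 : -1 - w = l * (1 - z) * (1 + z) / (- l + (1 - l) * z) by rewrite /w; field.
have z1' : 1 - z != 0 by rewrite subr_eq0 eq_sym.
have h3 : -1 + z ^+ 2 = - (1 - z) * (1 + z) by ring.
have n3 : -1 + z ^+ 2 != 0 by rewrite h3 !mulf_neq0// oppr_eq0.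
split => //; first by rewrite h1 !mulf_neq0// invr_eq0.
rewrite /cross h1 h2 opprK h3; field.
by rewrite d zN1 z1' z0.
Qed.

(** Möbius invariance reduces to the reference configuration, whose cross-ratios are [lam] by the
    choice of [Theta]. Hence the phases determine the leaf. *)
Lemma Lambda_coordinates a psi lam phi : disk a -> V lam ->
  coordinates a psi lam phi -> Lambda phi = lam.
Proof.
move=> da [lam01 _] co; apply/rowP => k; rewrite mxE /cross_ratio /ph !co.
have k3 : (k.+3 < N)%N by rewrite !ltnS -ltnS.
have Th j : (j < 3)%N -> expi (Theta lam 0 (inord j)) = - zeta ^+ j.
  move=> j3; have jE : (inord j : 'I_N) = j :> nat by rewrite inordK// (ltn_trans j3).
  by rewrite expi_Theta_lt3 jE.
have lk1 : lam 0 k < 1 by have /andP[] := lam01 k.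
have Thk : expi (Theta lam 0 (inord k.+3)) =
    zeta * ((lam 0 k)%:C + (lam 0 k)%:C * zeta - 1) /
      (- (lam 0 k)%:C + (1 - (lam 0 k)%:C) * zeta).
  have jE : (inord k.+3 : 'I_N) = k.+3 :> nat by rewrite inordK.
  have kE : inord (k.+3 - 3) = k by rewrite !subSS subn0 inord_val.
  have := @expi_Theta_ge3 lam (inord k.+3); rewrite jE kE => H.
  exact: H.
have den (x : R) : 1 + a^*%R * expi psi * expi x != 0.
  by rewrite -mulrA mobius_den_neq0// cabsM !cabs_expi mulr1.
have [n1 n2 cr] := cross_Theta (expi_neq0 _) zeta_neq1 zeta_neqN1 (zeta_den_neq0 lk1).
rewrite -Thk in n1 n2 cr.
pose e i := expi (Theta lam 0 (inord i)).
have := @cross_mobius a (expi psi) (e 0) (e 1) (e 2) (e k.+3) (expi_neq0 _) da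
  (den _) (den _) (den _) (den _).
rewrite /e (Th 0)// (Th 1)// (Th 2)// expr0 expr1 cr => H; rewrite [X in Re X]H//.
- by rewrite -subr_eq0.
- by rewrite -subr_eq0 opprK.
Qed.

(** Conjugation on the circle is inversion, which multiplies each difference by minus the inverse
    product of its two points; these factors cancel. Thus the [Re] in [Lambda] loses nothing. *)
Lemma conj_cross (x0 x1 x2 x3 : R) :
  (cross (expi x0) (expi x1) (expi x2) (expi x3))^*%R =
  cross (expi x0) (expi x1) (expi x2) (expi x3).
Proof.
have eB x y : (expi x - expi y)^*%R = - (expi x - expi y) / (expi x * expi y).
  have h u : (expi u)^*%R = (expi u)^-1.
    by apply: (mulfI (expi_neq0 u)); rewrite expi_conj mulfV ?expi_neq0.
  by rewrite rmorphB /= !h; field; rewrite !expi_neq0.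
rewrite /cross fmorph_div !rmorphM /= !eB.
set u := _ - expi x3; set v := _ - expi x2; set w := _ - expi x3; set t := _ - expi x2.
(* When the denominator vanishes both sides are 0, the inverse of 0 being 0. *)
have [->|w0] := eqVneq w 0; first by rewrite oppr0 !(mul0r, mulr0, invr0).
have [->|t0] := eqVneq t 0; first by rewrite oppr0 !(mul0r, mulr0, invr0).
by field; rewrite !expi_neq0 w0 t0.
Qed.

(** A point is determined by three others and the cross-ratio; since [lambda_star] consists of
    cross-ratios of equally spaced points, [Theta] gives these points back. *)
Lemma expi_Theta_star (j : 'I_N) : V (lambda_star R n) ->
  expi (Theta (lambda_star R n) 0 j) = - zeta ^+ j.
Proof.
move=> [V01 _]; have [j3|j3] := ltnP j 3; first exact: expi_Theta_lt3.
set k : 'I_n.+1 := inord (j - 3).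
have kE : k.+3 = j.
  by rewrite /k inordK ?ltn_subLR// -addn3 subnK.
have /andP[_ l1] := V01 k.
rewrite expi_Theta_ge3 -/k//.
have -> : (lambda_star R n 0 k)%:C =
    cross (- zeta ^+ 0) (- zeta ^+ 1) (- zeta ^+ 2) (- zeta ^+ j).
  have e m : (m < N)%N -> - zeta ^+ m = expi (theta_star R n 0 (inord m)).
    by move=> mN; rewrite expi_theta_star inordK.
  rewrite mxE /cross_ratio /ph kE inord_val !e// inord_val -/(cross _ _ _ _).
  set c := cross _ _ _ _.
  by rewrite complexRe; apply/Creal_ReP/CrealP; rewrite conj_cross.
have zj : zeta - zeta ^+ j != 0.
  rewrite subr_eq0 -[X in X == _]expr1; apply/eqP => /zetaX_inj.
  by move=> /(_ isT (ltn_ord j)) j1; move: j3; rewrite -j1.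
have := zeta_neqN1; have := expi_neq0 step; have := zeta_neq1.
rewrite eq_sym -subr_eq0 expr0 expr1 /cross.
move: zj; set w := zeta ^+ j; move: w zeta => w z zw z1 z0 zN1.
have -> : (-1 - - w) * (- z - - z ^+ 2) / ((- z - - w) * (-1 - - z ^+ 2)) =
   (1 - w) * z / ((z - w) * (1 + z)).
  have h : -1 - - z ^+ 2 = - (1 - z) * (1 + z) by ring.
  have h' : - z - - w = - (z - w) by ring.
  rewrite h h'; field.
  by rewrite zw z1 zN1.
have h1 : - ((1 - w) * z / ((z - w) * (1 + z))) +
   (1 - (1 - w) * z / ((z - w) * (1 + z))) * z = - z * (1 - z) / (z - w).
  by field; rewrite zw zN1.
by rewrite h1; field; rewrite zw z1 z0 zN1.
Qed.

End ReferencePoint.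

(** * Cyclic relabelling of the phases as a symmetry of the leaf of [lambda_star] *)

Section Rotation.
Variables (R : realType) (n : nat).
Local Notation N := n.+4.
Local Notation lams := (lambda_star R n).
Implicit Types (x y phi : 'rV[R]_N) (A : set 'rV[R]_N) (k : 'I_N).

(** Addition in ['I_N] is modulo [N], which makes this a cyclic shift. *)
Definition rotate k x : 'rV[R]_N := \row_j x 0 (j + k)%R.

Lemma rotateK k : cancel (rotate k) (rotate (- k)).
Proof. by move=> x; apply/rowP => j; rewrite !mxE subrK. Qed.

Lemma rotateNK k : cancel (rotate (- k)) (rotate k).
Proof. by move=> x; apply/rowP => j; rewrite !mxE addrK. Qed.

Lemma rotateB k x y : rotate k (x - y) = rotate k x - rotate k y.
Proof. by apply/rowP => j; rewrite !mxE. Qed.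

Lemma enorm_rotate k x : enorm (rotate k x) = enorm x.
Proof.
rewrite /enorm [in RHS](reindex_inj (addIr k)); congr Num.sqrt.
by apply: eq_bigr => j _; rewrite mxE.
Qed.

Lemma torus_dist_rotate k x A :
  torus_dist (rotate k x) (rotate k @` A) = torus_dist x A.
Proof.
congr inf; rewrite image_comp; apply: eq_imagel => y _ /=.
by rewrite -rotateB enorm_rotate.
Qed.

Lemma eqT_rotate k x y : eqT x y -> eqT (rotate k x) (rotate k y).
Proof. by move=> xy j; rewrite !mxE. Qed.

Lemma continuous_rotate k : continuous (rotate k).
Proof.
move=> x s /= /nbhs_ballP[e e0 es]; apply/nbhs_ballP; exists e => //= y [_ xy].
by apply: es; split => // i j; rewrite !mxE.
Qed.

Lemma ordered_rotate k x : ordered x -> ordered (rotate k x).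
Proof.
case=> y xy [inc wrap].
have ylt (i j : 'I_N) : y 0 i < y 0 j + 2 * pi.
  have le (a b : 'I_N) : (a <= b)%N -> y 0 a <= y 0 b.
    rewrite leq_eqVlt => /predU1P[/val_inj -> //|ab]; exact/ltW/inc.
  rewrite (le_lt_trans (le _ ord_max _))//; first by rewrite -ltnS.
  by rewrite (lt_le_trans wrap)// lerD2r le.
(* [q j] counts how often the index [j + k] wraps around; one full turn is added per wrap to keep
   the representatives increasing. *)
pose q (j : 'I_N) := ((j + k) %/ N)%N.
have val (j : 'I_N) : (q j * N + (j + k)%R = j + k)%N.
  exact/esym/divn_eq.
exists (\row_j (y 0 (j + k)%R + 2 * pi * (q j)%:R)).
  move=> j; rewrite !mxE; apply/eq2piE.
  have /eqTE -> := xy; apply/eq2piE.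
  exists (- (Posz (q j))); rewrite rmorphN /= -pmulrn; ring.
split.
- move=> i j ij; rewrite !mxE.
  have : (q i <= q j)%N by rewrite leq_div2r// leq_add2r ltnW.
  rewrite leq_eqVlt => /predU1P[e|lt].
    rewrite e ltrD2r; apply: inc.
    by rewrite -(ltn_add2l (q i * N)) {2}e !val ltn_add2r.
  have := ylt (i + k)%R (j + k)%R.
  have : (q i).+1%:R <= (q j)%:R :> R by rewrite ler_nat.
  have := pi_gt0 R; rewrite -natr1; nra.
- rewrite !mxE.
  have q0 : q ord0 = 0%N by rewrite /q add0n divn_small.
  have m0 : (ord0 + k)%R = k :> nat by have := val ord0; rewrite q0.
  have : (q ord_max * N + (ord_max + k)%R = n.+3 + k)%N := val ord_max.
  rewrite q0 mulr0 addr0.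
  (* If the last index wraps, it lands just before the image of the first one; if it does not, then
     [k] is 0 and the original wrap condition applies. *)
  have : (q ord_max <= 1)%N.
    by rewrite -ltnS ltn_divLR//; have := ltn_ord k; rewrite /=; lia.
  case: (q ord_max) => [|[|//]] _; last first.
    by rewrite mulr1 ltrD2r => mm; apply: inc; have := ltn_ord k; lia.
  rewrite mul0n add0n mulr0 addr0 => mm.
  have k0 : k = 0%N :> nat by have := ltn_ord (ord_max + k)%R; lia.
  have -> : (ord_max + k)%R = ord_max by apply: val_inj; rewrite /= in mm *; lia.
  by have -> : (ord0 + k)%R = ord0 by apply: val_inj; rewrite /= in m0 *; lia.
Qed.

Lemma expi_Theta_rotate k (j : 'I_N) : V lams ->
  expi (Theta lams 0 (j + k)%R) =
  expi (step R n *+ k) * expi (Theta lams 0 j).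
Proof.
move=> Vl; rewrite !expi_Theta_star// mulrN expi_mulrn -exprD addnC.
by rewrite [in RHS](divn_eq (j + k) N) exprD mulnC exprM zetaXN expr1n mul1r.
Qed.

Lemma coordinates_rotate k a psi phi : V lams ->
  coordinates a psi lams phi ->
  coordinates a (psi + step R n *+ k) lams (rotate k phi).
Proof.
by move=> Vl co j; rewrite mxE co expi_Theta_rotate// -mobius_add_angle.
Qed.

(** On this leaf the shift of [psi] only permutes the terms of the mean, so the reduced vector field
    does not change under it. *)
Lemma Zcoord_rotate k a psi : V lams ->
  Zcoord a (psi + step R n *+ k) lams = Zcoord a psi lams.
Proof.
move=> Vl; rewrite /Zcoord [in RHS](reindex_inj (addIr k)); congr (_ * _).
by apply: eq_bigr => j _; rewrite mobius_add_angle expi_Theta_rotate.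
Qed.

Variables (f : R[i] -> R[i]) (g : R[i] -> R).

Lemma reduced_solution_rotate k (I : set R) a psi lam :
  (forall t, I t -> lam t = lams) -> reduced_solution f g I a psi lam ->
  reduced_solution f g I a (fun t => psi t + step R n *+ k) lam.
Proof.
move=> lamE sol t It; have [[da Vl] a' [d psi' dE] lam'] := sol _ It.
rewrite lamE// in Vl; rewrite lamE// in a' dE *.
rewrite /= Zcoord_rotate//; split => //.
exists d => //; rewrite -[d]addr0; exact: is_deriveD.
Qed.

Lemma trajectory_rotate k (I : set R) (phi : R -> 'rV[R]_N) a psi lam :
  (forall t, I t -> {for t, continuous phi}) ->
  (forall t, I t -> lam t = lams) -> reduced_solution f g I a psi lam ->
  (forall t, I t -> coordinates (a t) (psi t) (lam t) (phi t)) ->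
  trajectory f g I (fun t => rotate k (phi t)).
Proof.
move=> cphi lamE sol co; split.
  move=> t It; apply: continuous_comp; [exact: cphi|exact: continuous_rotate].
exists a, (fun t => psi t + step R n *+ k), lam; split.
  exact: reduced_solution_rotate.
move=> t It; have [[_ Vl] _ _ _] := sol _ It; have := co _ It.
by rewrite lamE// in Vl *; exact: coordinates_rotate.
Qed.

(** A trajectory comes with a time-dependent [lam] of zero derivative; the mean value theorem in
    each entry keeps it in one leaf. *)
Lemma is_derive0_rV_cst p (lam : R -> 'rV[R]_p) (s1 s2 : R) :
  (forall t, s1 < t < s2 -> is_derive t 1 lam 0) ->
  forall s t, s1 < s < s2 -> s1 < t < s2 -> lam s = lam t.
Proof.
move=> d0 s t; wlog st : s t / s <= t.
  move=> H; have [/H|/ltW/H] := leP s t; first exact.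
  by move=> e *; rewrite e.
move=> /andP[s1s ss2] /andP[s1t ts2]; apply/rowP => j.
have dj u : s1 < u < s2 -> is_derive u 1 (fun v => lam v 0 j) 0.
  move=> us; have [der e] : is_derive u 1 lam 0 by exact: d0.
  have /derivable_mxP derj := der.
  split; first exact: derj.
  by have := derive_mx der; rewrite e => /matrixP/(_ 0 j); rewrite !mxE.
have dst u : u \in `[s, t] -> is_derive u 1 (fun v => lam v 0 j) 0.
  by rewrite in_itv /= => /andP[su ut]; apply: dj; apply/andP; split; lra.
have dst' u : u \in `]s, t[ -> is_derive u 1 (fun v => lam v 0 j) 0.
  by move=> su; apply: dst; apply: subset_itv_oo_cc su.
have cst : {within `[s, t], continuous (fun v => lam v 0 j)}.
  by apply: derivable_within_continuous => u /dst[].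
have [u _ /eqP] := MVT_segment st dst' cst.
by rewrite mul0r subr_eq0 => /eqP.
Qed.

End Rotation.

(** * Rotation of flow lines and of stable periodic orbits *)

Section OrbitRotation.
Variables (R : realType) (n : nat) (f : R[i] -> R[i]) (g : R[i] -> R).
Local Notation N := n.+4.
Local Notation lams := (lambda_star R n).
Hypothesis Vl : V lams.
Implicit Types (x y : 'rV[R]_N) (O : set 'rV[R]_N) (k : 'I_N).

Lemma level_rotate k a psi x : disk a -> coordinates a psi lams x ->
  ordered x -> level lams (rotate k x).
Proof.
move=> da co ox; split; first exact: ordered_rotate.
exact: Lambda_coordinates (coordinates_rotate k Vl co).
Qed.

(** The starting point fixes [lam 0], and [lam] is constant, so the whole trajectory lies in the
    symmetric leaf. *)
Lemma flow_rel_rotate k t x y : level lams x -> flow_rel f g t x y ->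
  level lams (rotate k x) /\ flow_rel f g t (rotate k x) (rotate k y).
Proof.
move=> [ox Lx] [s1 [s2 [phi [/andP[s10 s20] st tr phi0 phit]]]].
case: tr => cphi [a [psi [lam [sol co]]]].
have I0 : [set` `]s1, s2[] 0 by rewrite /= in_itv/= s10 s20.
have [[da V0] _ _ _] := sol _ I0.
have lam0 : lam 0 = lams.
  by rewrite -Lx -phi0; apply/esym; exact: Lambda_coordinates (co _ I0).
have lamE u : [set` `]s1, s2[] u -> lam u = lams.
  rewrite -lam0 => us; apply: (@is_derive0_rV_cst _ _ lam s1 s2).
  - by move=> v vs; have [] := sol v; rewrite /= ?in_itv.
  - by move: us; rewrite /= in_itv.
  - by rewrite s10.
split.
  by apply: level_rotate ox; [exact: da|have := co _ I0; rewrite lam0 phi0; exact].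
exists s1, s2, (fun u => rotate k (phi u)); rewrite phi0 phit s10 s20; split=> //.
exact: trajectory_rotate sol co.
Qed.

(** Rotation is invertible, commutes with the flow on the leaf and preserves [torus_dist]; each
    clause is transported, the stability estimate with the same constants. *)
Lemma stable_orbit_rotate k O :
  stable_orbit_in_level f g lams O -> stable_orbit_in_level f g lams (rotate k @` O).
Proof.
case=> [[T [phi [T0 [cphi [a [psi [lam [sol co]]]]] per nconst OE]]] OL].
have Ophi t : O (phi t) by rewrite OE; exists t => j; exists 0; rewrite mulr0 addr0.
have lamE t : setT t -> lam t = lams.
  move=> _; have [[da V0] _ _ _] := sol t I.
  have [_ <-] := OL _ (Ophi t).
  by apply/esym; exact: Lambda_coordinates (co _ I).
move=> [eta [K [mu [eta0 K0 mu0 stab]]]]; split.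
- exists T, (fun u => rotate k (phi u)); split => //.
  + exact: trajectory_rotate sol co.
  + by move=> t; apply: eqT_rotate.
  + move=> H; apply: nconst => t.
    by have := eqT_rotate (- k) (H t); rewrite !rotateK.
  + rewrite OE; apply/seteqP; split => [_ [x [t xt] <-]|x [t xt]].
      by exists t; exact: eqT_rotate.
    exists (rotate (- k) x); last exact: rotateNK.
    by exists t; have := eqT_rotate (- k) xt; rewrite rotateK.
- move=> _ [x Ox <-]; have [ox _] := OL _ Ox.
  have := Ox; rewrite OE => -[t xt].
  have [[da V0] _ _ _] := sol t I.
  have cx : coordinates (a t) (psi t) lams x.
    move=> j; have /eqTE -> := xt.
    by have := co t I; rewrite lamE//; exact.
  exact: level_rotate cx ox.
- exists eta, K, mu; split => // x Lx dx t y t0 fl.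
  have [Lx' fl'] := flow_rel_rotate (- k) Lx fl.
  rewrite -(rotateNK k x) -(rotateNK k y) !torus_dist_rotate.
  apply: stab fl' => //.
  by rewrite -(torus_dist_rotate k) rotateNK.
Qed.

End OrbitRotation.

(** * Lipschitz bounds on smaller discs and a Gronwall argument *)

Section LocalLipschitz.
Variable R : realType.
Implicit Types (h : R[i] -> R) (z w : R[i]) (r : R).

Lemma cabs_sqr z : cabs z ^+ 2 = Re z ^+ 2 + Im z ^+ 2.
Proof. by rewrite sqr_sqrtr// addr_ge0 ?sqr_ge0. Qed.

Lemma disk_sqr z : disk z <-> Re z ^+ 2 + Im z ^+ 2 < 1.
Proof. by rewrite -cabs_sqr expr_lt1// sqrtr_ge0. Qed.

Lemma compact_disk_bounded (G : R * R -> R) r : 0 <= r < 1 ->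
  (forall p, disk (p.1 +i* p.2) -> {for p, continuous G}) ->
  exists2 B, 0 <= B & forall p, p.1 ^+ 2 + p.2 ^+ 2 <= r -> `|G p| <= B.
Proof.
move=> /andP[r0 r1] cG; pose K := [set p : R * R | p.1 ^+ 2 + p.2 ^+ 2 <= r].
have cK : compact K.
  apply: (subclosed_compact _ (compact_setX (@segment_compact R (-1) 1)
    (@segment_compact R (-1) 1))).
    apply: (@closed_comp _ _ (fun p : R * R => p.1 ^+ 2 + p.2 ^+ 2) [set x | x <= r]).
      move=> p _; apply: cvgD.
        by apply: (@continuous_comp _ _ _ fst (fun x : R => x ^+ 2));
          [exact: cvg_fst|exact: exprn_continuous].
      by apply: (@continuous_comp _ _ _ snd (fun x : R => x ^+ 2));
        [exact: cvg_snd|exact: exprn_continuous].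
    exact: closed_le.
  move=> [x y]; rewrite /K /= => xy.
  by split; rewrite /= in_itv/=; apply/andP; split; nra.
have cGK : {within K, continuous (fun p => `|G p|)}.
  apply: continuous_in_subspaceT => p; rewrite inE => Kp.
  apply: continuous_comp; last exact: norm_continuous.
  by apply: cG; apply/disk_sqr; exact: le_lt_trans r1.
have K0 : K !=set0 by exists (0, 0); rewrite /K/= expr0n/= addr0.
have [c _ cmax] := compact_EVT_max K0 cK cGK.
by exists `|G c| => // p pr; apply: cmax; rewrite inE.
Qed.

(** The mean value theorem along a segment, with both partial derivatives bounded on the compact
    disc of squared radius [r]. *)
Lemma smooth_on_disk_lipschitz h r : smooth_on_disk h -> 0 <= r < 1 ->
  exists2 L, 0 <= L & forall z w,
    Re z ^+ 2 + Im z ^+ 2 <= r -> Re w ^+ 2 + Im w ^+ 2 <= r ->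
    `|h w - h z| <= L * (`|Re w - Re z| + `|Im w - Im z|).
Proof.
move=> hs r01; have /= [dh ch] := hs 1%N.
pose H (p : R * R) := h (p.1 +i* p.2).
have [B1 B10 HB1] := @compact_disk_bounded (fun p => 'D_(1, 0) H p) r r01 (ch (1, 0)).
have [B2 B20 HB2] := @compact_disk_bounded (fun p => 'D_(0, 1) H p) r r01 (ch (0, 1)).
exists (B1 + B2); first exact: addr_ge0.
move=> [z1 z2] [w1 w2] /= zr wr.
pose v : R * R := (w1 - z1, w2 - z2).
pose gam (s : R) : R * R := s *: v + (z1, z2).
have gamr (s : R) : 0 <= s <= 1 -> (gam s).1 ^+ 2 + (gam s).2 ^+ 2 <= r.
  move=> /andP[s0 s1]; rewrite /gam /= /v/=.
  (* Convexity of the disc: along the segment the squared norm is the convex combination of its end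
     values minus a nonnegative term. *)
  have -> : (s *: (w1 - z1) + z1) ^+ 2 + (s *: (w2 - z2) + z2) ^+ 2 =
    (1 - s) * (z1 ^+ 2 + z2 ^+ 2) + s * (w1 ^+ 2 + w2 ^+ 2)
      - s * (1 - s) * ((w1 - z1) ^+ 2 + (w2 - z2) ^+ 2).
    by rewrite /GRing.scale /=; ring.
  have p0 : 0 <= s * (1 - s) * ((w1 - z1) ^+ 2 + (w2 - z2) ^+ 2).
    by rewrite !mulr_ge0 ?subr_ge0// addr_ge0 ?sqr_ge0.
  have p1 : (1 - s) * (z1 ^+ 2 + z2 ^+ 2) <= (1 - s) * r by rewrite ler_wpM2l ?subr_ge0.
  have p2 : s * (w1 ^+ 2 + w2 ^+ 2) <= s * r by rewrite ler_wpM2l.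
  by lra.
have gdisk (s : R) : 0 <= s <= 1 -> disk ((gam s).1 +i* (gam s).2).
  by move=> s01; apply/disk_sqr; case/andP: r01 => _; exact/le_lt_trans/gamr.
have dgam (s : R) : 0 <= s <= 1 -> is_derive s (1 : R) (H \o gam) ('D_v H (gam s)).
  move=> s01; have der : derivable H (gam s) v by exact/diff_derivable/dh/gdisk.
  (* Since [gam] is affine, the difference quotients of [H \o gam] are literally those of [H] in
     direction [v]. *)
  have e : (fun x : R => x^-1 *: (((H \o gam) \o shift s) (x *: 1) - (H \o gam) s)) =
      (fun x : R => x^-1 *: ((H \o shift (gam s)) (x *: v) - H (gam s))).
    apply/funext => x /=; congr (_ *: (H _ - _)).
    by rewrite /gam scalerDl addrA [x *: 1]mulr1.
  by split; rewrite /derivable /derive e//.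
have cgam : {within `[0, 1], continuous (H \o gam)}.
  apply: derivable_within_continuous => s; rewrite in_itv/= => /dgam[]//.
have dgam' (s : R) : s \in `]0, 1[ -> is_derive s 1 (H \o gam) ('D_v H (gam s)).
  by move=> /subset_itv_oo_cc; rewrite in_itv; exact: dgam.
have [s s01] := MVT_segment ler01 dgam' cgam.
rewrite in_itv/= in s01; rewrite /= /gam scale1r scale0r add0r subr0 mulr1.
have -> : v + (z1, z2) = (w1, w2) by rewrite /v; congr (_, _); rewrite /= subrK.
rewrite /H/= -/(gam s) => ->.
have dHs := dh _ (gdisk _ s01).
have -> : 'D_v H (gam s) =
    (w1 - z1) * 'D_(1, 0) H (gam s) + (w2 - z2) * 'D_(0, 1) H (gam s).
  rewrite !deriveE//.
  have -> : v = (w1 - z1) *: ((1, 0) : R * R) + (w2 - z2) *: ((0, 1) : R * R).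
    by rewrite /v; congr (_, _); rewrite /= /GRing.scale/=; ring.
  by rewrite linearD !linearZ.
rewrite (le_trans (ler_normD _ _))// !normrM.
have b1 := HB1 _ (gamr _ s01); have b2 := HB2 _ (gamr _ s01).
have n1 := normr_ge0 (w1 - z1); have n2 := normr_ge0 (w2 - z2).
by nra.
Qed.

Lemma cos_lipschitz (x y : R) : `|cos x - cos y| <= `|x - y|.
Proof.
wlog xy : x y / y <= x.
  move=> H; have [/H //|/ltW/H] := leP y x.
  by rewrite distrC (distrC y).
have [c _ ->] := @MVT_segment R cos (fun x => - sin x) y x xy
  (fun x _ => is_derive_cos x) (continuous_subspaceT (@continuous_cos R)).
by rewrite normrM normrN ler_piMl// sin_max.
Qed.

Lemma sin_lipschitz (x y : R) : `|sin x - sin y| <= `|x - y|.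
Proof.
wlog xy : x y / y <= x.
  move=> H; have [/H //|/ltW/H] := leP y x.
  by rewrite distrC (distrC y).
have [c _ ->] := @MVT_segment R sin cos y x xy
  (fun x _ => is_derive_sin x) (continuous_subspaceT (@continuous_sin R)).
by rewrite normrM ler_piMl// cos_max.
Qed.

(** The weighted function [E t * expR (- c * t)] has nonpositive derivative, so it cannot rise above
    its initial value 0. *)
Lemma gronwall_eq0 (E dE : R -> R) (c S : R) : 0 <= S ->
  (forall t, 0 <= t <= S -> is_derive t 1 E (dE t)) ->
  (forall t, 0 <= t <= S -> 0 <= E t) ->
  (forall t, 0 <= t <= S -> dE t <= c * E t) -> E 0 = 0 -> E S = 0.
Proof.
move=> S0 der E0 dEle E00.
pose F t := E t * expR (- c * t).
have dF (t : R) : 0 <= t <= S -> is_derive t 1 F ((dE t - c * E t) * expR (- c * t)).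
  move=> t0; have dEt := der t t0.
  have dexp : is_derive t 1 (expR \o ( *%R (- c))) (expR (- c * t) * - c).
    apply: is_derive1_comp.
    by have := is_deriveZ (- c) (is_derive_id t (1 : R)); rewrite scaler1.
  apply: is_derive_eq (is_deriveM dEt dexp) _.
  by rewrite /= /GRing.scale /=; ring.
have cF : {within `[0, S], continuous F}.
  by apply: derivable_within_continuous => t; rewrite in_itv/= => /dF[].
have dF' (t : R) : t \in `]0, S[ -> is_derive t 1 F ((dE t - c * E t) * expR (- c * t)).
  by move=> /subset_itv_oo_cc; rewrite in_itv; exact: dF.
have [t + FS] := MVT_segment S0 dF' cF.
rewrite in_itv/= => t0.
have : F S <= F 0.
  rewrite -subr_le0 FS subr0 mulr_le0_ge0// mulr_le0_ge0 ?expR_ge0// subr_le0.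
  exact: dEle.
rewrite /F E00 mul0r pmulr_lle0 ?expR_gt0// => ES.
by apply/eqP; rewrite eq_le ES E0// lexx S0.
Qed.

End LocalLipschitz.

(** * Forward uniqueness for the phase equations *)

Section PhaseUniqueness.
Variables (R : realType) (n : nat).
Local Notation N := n.+4.
Implicit Types (phi : 'rV[R]_N).

Lemma realM_complex (a x y : R) : a%:C * (x +i* y) = (a * x) +i* (a * y).
Proof. by simpc. Qed.

Lemma sum_complex (I : finType) (F G : I -> R) :
  \sum_i (F i +i* G i) = (\sum_i F i) +i* (\sum_i G i).
Proof.
by elim/big_rec3: _ => // i z y x _ ->.
Qed.

Lemma ZphaseE phi : Zphase phi =
  (N%:R^-1 * \sum_j cos (phi 0 j)) +i* (N%:R^-1 * \sum_j sin (phi 0 j)).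
Proof.
rewrite /Zphase sum_complex -realM_complex; congr (_ * _).
by rewrite fmorphV rmorph_nat.
Qed.

(* The variance of N points of the unit circle is 1 - |mean|^2. *)
Lemma Zphase_disk phi : ordered phi -> disk (Zphase phi).
Proof.
case=> y /eqTE xy [inc wrap]; apply/disk_sqr; rewrite ZphaseE /=.
set C := N%:R^-1 * _; set S := N%:R^-1 * _.
have N0 : (N%:R : R) != 0 by rewrite pnatr_eq0.
have CE : \sum_j cos (phi 0 j) = N%:R * C by rewrite /C mulVKf.
have SE : \sum_j sin (phi 0 j) = N%:R * S by rewrite /S mulVKf.
pose v j := (cos (phi 0 j) - C) ^+ 2 + (sin (phi 0 j) - S) ^+ 2.
have v0 j : 0 <= v j by rewrite addr_ge0 ?sqr_ge0.
have var : \sum_j v j = N%:R * (1 - (C ^+ 2 + S ^+ 2)).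
  have vE j : v j = 1 + C ^+ 2 + S ^+ 2 - 2 * C * cos (phi 0 j) - 2 * S * sin (phi 0 j).
    have := cos2Dsin2 (phi 0 j); rewrite /v.
    by move: (cos _) (sin _) => c s; lra.
  rewrite (eq_bigr _ (fun j _ => vE j)) !big_split/= !sumrN.
  rewrite !sumr_const card_ord -!mulr_sumr CE SE.
  by rewrite -(mulr_natl (C ^+ 2)) -(mulr_natl (S ^+ 2)); ring.
rewrite ltNge; apply/negP => ge1.
have vz j : v j = 0.
  have s0 : \sum_j v j = 0.
    apply/eqP; rewrite eq_le sumr_ge0// andbT var.
    by rewrite mulr_ge0_le0// subr_le0.
  by have /psumr_eq0P := s0; apply.
have e j : expi (phi 0 j) = C +i* S.
  have := vz j; rewrite /v => /eqP; rewrite paddr_eq0 ?sqr_ge0//.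
  by rewrite !sqrf_eq0 !subr_eq0 => /andP[/eqP c /eqP s]; rewrite /expi c s.
have lt := inc ord0 ord_max isT.
have : expi (y 0 ord_max - y 0 ord0) = 1.
  by rewrite expiD expiN -!xy !e -(e ord0) expi_conj.
move/expi_eq1 => H; have : y 0 ord_max - y 0 ord0 = 0.
  by apply: H; apply/andP; split; lra.
by lra.
Qed.

Variables (f : R[i] -> R[i]) (g : R[i] -> R).
Hypotheses (hf : smooth_on_diskc f) (hg : smooth_on_disk g).

(** The real form of the phase equation: its two conjugate terms add up to twice a real part. *)
Definition phase_rhs phi (j : 'I_N) : R :=
  2 * (Re (f (Zphase phi)) * cos (phi 0 j) - Im (f (Zphase phi)) * sin (phi 0 j))
  + g (Zphase phi).

Lemma phase_rhsE (a : R[i]) (b x d : R) :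
  d%:C = a * expi x + b%:C + a^*%R * expi (- x) <->
  d = 2 * (Re a * cos x - Im a * sin x) + b.
Proof.
case: a => a1 a2; rewrite expiN /expi !conj_pair; simpc => /=.
split=> [[-> _]|->]; first by ring.
by congr (_ +i* _); ring.
Qed.

Lemma phase_solutionP (x : R -> 'rV[R]_N) : phase_solution f g x <->
  forall (t : R) j, is_derive t 1 (fun s => x s 0 j) (phase_rhs (x t) j).
Proof.
split=> [sol t j|sol t j].
  by have [d dx /phase_rhsE e] := sol t j; rewrite /phase_rhs -e.
by exists (phase_rhs (x t) j) => //; apply/phase_rhsE.
Qed.

Lemma continuous_scaled_sum (c : R) (h : 'I_N -> R -> R) :
  (forall j, continuous (h j)) -> continuous (fun t => c * \sum_j h j t).
Proof.
move=> ch t; apply: (cvgM (cvg_cst c)).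
by apply: (@continuous_big _ _ +%R 0 xpredT add_continuous) => j _; exact: ch.
Qed.

(** Lipschitz constants are available on smaller discs only. On a compact time interval the squared
    modulus of the order parameter attains its maximum, which [Zphase_disk] puts below 1. *)
Lemma Zphase_bound (x : R -> 'rV[R]_N) (S : R) : 0 <= S ->
  (forall (t : R) j, derivable (fun s => x s 0 j) t 1) ->
  (forall t, ordered (x t)) ->
  exists2 r, 0 <= r < 1 & forall t, 0 <= t <= S ->
    Re (Zphase (x t)) ^+ 2 + Im (Zphase (x t)) ^+ 2 <= r.
Proof.
move=> S0 dx ox.
pose F (t : R) := Re (Zphase (x t)) ^+ 2 + Im (Zphase (x t)) ^+ 2.
have cx j : continuous (fun s => x s 0 j).
  by move=> t; apply/differentiable_continuous/derivable1_diffP/dx.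
have cF : continuous F.
  have cC : continuous (fun t => N%:R^-1 * \sum_j cos (x t 0 j)).
    apply: continuous_scaled_sum => j t.
    by apply: (continuous_comp (cx j t)); exact: continuous_cos.
  have cS : continuous (fun t => N%:R^-1 * \sum_j sin (x t 0 j)).
    apply: continuous_scaled_sum => j t.
    by apply: (continuous_comp (cx j t)); exact: continuous_sin.
  have -> : F = (fun t => (N%:R^-1 * \sum_j cos (x t 0 j)) ^+ 2 +
                          (N%:R^-1 * \sum_j sin (x t 0 j)) ^+ 2).
    by apply/funext => t; rewrite /F ZphaseE.
  move=> t; apply: cvgD.
    exact: (continuous_comp (cC t) (@exprn_continuous R 2 _)).
  exact: (continuous_comp (cS t) (@exprn_continuous R 2 _)).
have [c _ cmax] := EVT_max S0 (continuous_subspaceT cF).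
exists (F c); last by move=> t t0; apply: cmax; rewrite in_itv.
by rewrite addr_ge0 ?sqr_ge0//=; apply/disk_sqr/Zphase_disk.
Qed.

(** Cauchy-Schwarz against the constant vector, by bounding each product in the double sum by the
    mean of the two squares. *)
Lemma sqr_sum_norm_le (u : 'I_N -> R) :
  (\sum_j `|u j|) * (\sum_j `|u j|) <= N%:R * \sum_j u j ^+ 2.
Proof.
rewrite [leLHS]mulr_sumr.
have -> : N%:R * \sum_j u j ^+ 2 =
    \sum_(i < N) \sum_(j < N) ((u i ^+ 2 + u j ^+ 2) / 2).
  apply/esym; under eq_bigr do rewrite -mulr_suml big_split/= sumr_const card_ord.
  rewrite -mulr_suml big_split/= sumr_const card_ord sumrMnl.
  by rewrite -(mulr_natl (\sum_i u i ^+ 2)); field.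
apply: ler_sum => i _; rewrite mulr_suml; apply: ler_sum => j _.
rewrite -(real_normK (num_real (u i))) -(real_normK (num_real (u j))).
have := sqr_ge0 (`|u i| - `|u j|); nra.
Qed.

(** The bound is in terms of [u], not of [x - y], because representatives of nearby phases may
    differ by multiples of 2 pi; only sines and cosines are compared. *)
Lemma phase_rhs_lipschitz (r : R) : 0 <= r < 1 -> exists2 K, 0 <= K &
  forall (x y : 'rV[R]_N) (u : 'I_N -> R),
    (forall j, `|cos (x 0 j) - cos (y 0 j)| <= `|u j|) ->
    (forall j, `|sin (x 0 j) - sin (y 0 j)| <= `|u j|) ->
    Re (Zphase x) ^+ 2 + Im (Zphase x) ^+ 2 <= r ->
    Re (Zphase y) ^+ 2 + Im (Zphase y) ^+ 2 <= r ->
    forall j, `|phase_rhs x j - phase_rhs y j| <= K * \sum_k `|u k|.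
Proof.
move=> r01; have [hf1 hf2] := hf.
have [L1 L10 lip1] := smooth_on_disk_lipschitz hf1 r01.
have [L2 L20 lip2] := smooth_on_disk_lipschitz hf2 r01.
have [L3 L30 lip3] := smooth_on_disk_lipschitz hg r01.
(* Bounds for the two parts of [f] on the disc: the value at 0 plus the Lipschitz constant times 2,
   each coordinate being at most 1 in absolute value. *)
pose M1 := `|Re (f 0)| + L1 * 2; pose M2 := `|Im (f 0)| + L2 * 2.
have bnd (h : R[i] -> R) L : 0 <= L ->
    (forall z w, Re z ^+ 2 + Im z ^+ 2 <= r -> Re w ^+ 2 + Im w ^+ 2 <= r ->
      `|h w - h z| <= L * (`|Re w - Re z| + `|Im w - Im z|)) ->
    forall z, Re z ^+ 2 + Im z ^+ 2 <= r -> `|h z| <= `|h 0| + L * 2.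
  move=> L0 lip z zr; case/andP: r01 => r0 r1.
  have := lip 0 z; rewrite /= expr0n /= addr0 !subr0 => /(_ r0 zr) hz.
  have n1 : `|Re z| <= 1 by rewrite ler_norml; apply/andP; split; nra.
  have n2 : `|Im z| <= 1 by rewrite ler_norml; apply/andP; split; nra.
  have := ler_normD (h z - h 0) (h 0); rewrite subrK.
  have := normr_ge0 (Re z); have := normr_ge0 (Im z); nra.
have M10 : 0 <= M1 by rewrite addr_ge0// mulr_ge0.
have M20 : 0 <= M2 by rewrite addr_ge0// mulr_ge0.
(* Each product of a part of [f] with a sine or cosine varies by at most [2 * L + M] times the sum;
   [g] contributes [2 * L3]. *)
exists (2 * (2 * L1 + M1 + (2 * L2 + M2)) + 2 * L3).
  by rewrite !(addr_ge0, mulr_ge0).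
move=> x y u cu su xr yr j.
set S := \sum_k `|u k|.
have uS : `|u j| <= S by rewrite /S (bigD1 j)//= lerDl sumr_ge0.
have mean (F G : 'I_N -> R) : (forall k, `|F k - G k| <= `|u k|) ->
    `|N%:R^-1 * \sum_k F k - N%:R^-1 * \sum_k G k| <= S.
  move=> FG; rewrite -mulrBr -sumrB normrM ger0_norm ?invr_ge0//.
  rewrite (@le_trans _ _ (`|\sum_k (F k - G k)|))//.
    by rewrite ler_piMl// invf_le1 ?ltr0n// ler1n.
  by rewrite (le_trans (ler_norm_sum _ _ _))// ler_sum.
have dC : `|Re (Zphase x) - Re (Zphase y)| <= S by rewrite !ZphaseE; exact: mean.
have dS : `|Im (Zphase x) - Im (Zphase y)| <= S by rewrite !ZphaseE; exact: mean.
have lipS (h : R[i] -> R) L : 0 <= L ->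
    (forall z w, Re z ^+ 2 + Im z ^+ 2 <= r -> Re w ^+ 2 + Im w ^+ 2 <= r ->
      `|h w - h z| <= L * (`|Re w - Re z| + `|Im w - Im z|)) ->
    `|h (Zphase x) - h (Zphase y)| <= 2 * L * S.
  move=> L0 lip; rewrite (le_trans (lip _ _ yr xr))//.
  by rewrite (mulrC 2) -mulrA ler_wpM2l// mulr_natl mulr2n lerD.
have prod (a b c d A B : R) : `|a - b| <= A -> `|b| <= B -> `|c - d| <= S ->
    `|c| <= 1 -> `|a * c - b * d| <= A + B * S.
  move=> ab bB cd c1; have -> : a * c - b * d = (a - b) * c + b * (c - d) by ring.
  rewrite (le_trans (ler_normD _ _))// !normrM lerD//; last exact: ler_pM.
  by rewrite -[A]mulr1 ler_pM.
have p1 := prod _ _ _ _ _ _ (lipS _ _ L10 lip1) (bnd _ _ L10 lip1 _ yr)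
  (le_trans (cu j) uS) (cos_max (x 0 j)).
have p2 := prod _ _ _ _ _ _ (lipS _ _ L20 lip2) (bnd _ _ L20 lip2 _ yr)
  (le_trans (su j) uS) (sin_max (x 0 j)).
have p3 := lipS _ _ L30 lip3.
rewrite -/M1 in p1; rewrite -/M2 in p2.
rewrite /phase_rhs; move: p1 p2 p3; rewrite !ler_norml.
by move=> /andP[? ?] /andP[? ?] /andP[? ?]; apply/andP; split; lra.
Qed.

Lemma phase_solution_unique (x y : R -> 'rV[R]_N) :
  phase_solution f g x -> phase_solution f g y ->
  (forall t, ordered (x t)) -> (forall t, ordered (y t)) ->
  eqT (x 0) (y 0) -> forall t, 0 <= t -> eqT (x t) (y t).
Proof.
move=> /phase_solutionP dx /phase_solutionP dy ox oy xy0 S S0.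
have [r1 r101 xr] := @Zphase_bound x S S0
  (fun t j => @ex_derive _ _ _ _ _ _ _ (dx t j)) ox.
have [r2 r201 yr] := @Zphase_bound y S S0
  (fun t j => @ex_derive _ _ _ _ _ _ _ (dy t j)) oy.
pose r := Num.max r1 r2.
have r01 : 0 <= r < 1 by rewrite /r; case: (leP r1 r2).
have [K K0 lip] := phase_rhs_lipschitz r01.
(* The subtracted initial difference is a multiple of 2 pi: [u] starts at 0, and [x - u] still
   represents the same phases as [y]. *)
pose u j (t : R) := x t 0 j - y t 0 j - (x 0 0 j - y 0 0 j).
have du (t : R) j : is_derive t 1 (u j) (phase_rhs (x t) j - phase_rhs (y t) j).
  have := is_deriveB (is_deriveB (dx t j) (dy t j))
    (is_derive_cst (x 0 0 j - y 0 0 j) t (1 : R)).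
  by rewrite subr0.
pose E (t : R) := \sum_j u j t ^+ 2.
pose D t j := phase_rhs (x t) j - phase_rhs (y t) j.
have dE (t : R) : is_derive t 1 E (\sum_j 2 * u j t * D t j).
  have -> : E = \sum_(j < N) (u j ^+ 2) by apply/funext => s; rewrite fct_sumE.
  apply: is_derive_eq (is_derive_sum (fun j => is_deriveX 2 (du t j))) _.
  by apply: eq_bigr => j _; rewrite /= expr1.
have xyE j : expi (x 0 0 j - y 0 0 j) = 1.
  by have /eqTE e := xy0; rewrite expiD expiN e expi_conj.
have ux t j : expi (x t 0 j - u j t) = expi (y t 0 j).
  have -> : x t 0 j - u j t = y t 0 j + (x 0 0 j - y 0 0 j) by rewrite /u; ring.
  by rewrite expiD xyE mulr1.
have ES : E S = 0.
  (* The 2 comes from differentiating squares, [K] is the Lipschitz constant and [N] is the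
     Cauchy-Schwarz factor. *)
  apply: (@gronwall_eq0 _ E _ (2 * K * N%:R) S S0 (fun t _ => dE t)).
  - by move=> t _; apply: sumr_ge0 => j _; exact: sqr_ge0.
  - move=> t t0.
    have cu j : `|cos (x t 0 j) - cos (y t 0 j)| <= `|u j t|.
      have := ux t j => -[<- _]; rewrite (le_trans (cos_lipschitz _ _))//.
      by rewrite subKr.
    have su j : `|sin (x t 0 j) - sin (y t 0 j)| <= `|u j t|.
      have := ux t j => -[_ <-]; rewrite (le_trans (sin_lipschitz _ _))//.
      by rewrite subKr.
    have xrt : Re (Zphase (x t)) ^+ 2 + Im (Zphase (x t)) ^+ 2 <= r.
      by rewrite (le_trans (xr t t0))// le_max lexx.
    have yrt : Re (Zphase (y t)) ^+ 2 + Im (Zphase (y t)) ^+ 2 <= r.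
      by rewrite (le_trans (yr t t0))// le_max lexx orbT.
    have Dle := lip _ _ _ cu su xrt yrt.
    rewrite (@le_trans _ _ (\sum_j 2 * (K * \sum_k `|u k t|) * `|u j t|))//.
      apply: ler_sum => j _; rewrite (le_trans (ler_norm _))// !normrM normr_nat.
      rewrite -!mulrA ler_pM2l// mulrC mulrA.
      by rewrite ler_wpM2r// ; exact: Dle.
    rewrite -mulr_sumr -!mulrA ler_pM2l// ler_wpM2l//.
    exact: (sqr_sum_norm_le (fun j => u j t)).
  - by rewrite /E big1// => j _; rewrite /u subrr expr0n.
apply/eqTE => j; rewrite -(ux S j).
have -> : u j S = 0; last by rewrite subr0.
have /psumr_eq0P := ES => /(_ (fun j _ => sqr_ge0 _) j isT) /eqP.
by rewrite sqrf_eq0 => /eqP.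
Qed.

End PhaseUniqueness.

(** * A differentiable real lift of the Möbius action on the circle *)

Section MobiusLift.
Variable R : realType.
Implicit Types (a q z w F : R[i]) (b c s x y : R).

(* [1 + a * expi (- b)] has positive real part for [a] in the disk, so that its
   argument is an arctangent. *)
Definition lift_den a b : R[i] :=
  (1 + Re a * cos b + Im a * sin b) +i* (Im a * cos b - Re a * sin b).

(** Write [E = expi b], [q = 1 + a / E], and [a'], [q'] for the conjugates. Then
    [(a + E) / (1 + a' * E)] equals [E * q / q'], whose argument is [b] plus twice that of [q]; as
    [Re q > 0] on the disk, no branch cut is met. *)
Definition mobius_lift a b : R :=
  b + 2 * atan (Im (lift_den a b) / Re (lift_den a b)).

Lemma lift_denE a b : lift_den a b = 1 + a * (expi b)^*%R.
Proof.
case: a => x y; rewrite /lift_den /expi conj_pair; simpc.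
by congr (_ +i* _) => /=; ring.
Qed.

(** Expand the nonnegative squared modulus of [a + expi b] and use that [a] has modulus below 1. *)
Lemma Re_lift_den_gt0 a b : disk a -> 0 < Re (lift_den a b).
Proof.
move=> /disk_sqr; case: a => x y /= xy; have := cos2Dsin2 b.
move: (cos b) (sin b) => c s cs.
have := sqr_ge0 (x + c); have := sqr_ge0 (y + s); nra.
Qed.

Lemma expi_atan x : expi (atan x) = (Num.sqrt (1 + x ^+ 2))^-1%:C * (1 +i* x).
Proof.
have c0 : cos (atan x) != 0.
  by rewrite cos_atan invr_eq0 sqrtr_eq0 -ltNge; have := sqr_ge0 x; lra.
have -> : expi (atan x) = cos (atan x) +i* (cos (atan x) * x).
  by rewrite -[X in _ * X]atanK /tan mulrC divfK.
by rewrite cos_atan realM_complex mulr1.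
Qed.

Lemma expi_double_atan x : expi (2 * atan x) = (1 +i* x) / (1 +i* x)^*%R.
Proof.
have d0 : 0 < 1 + x ^+ 2 by have := sqr_ge0 x; lra.
have n0 : (1 +i* x)^*%R * (1 +i* x) = (1 + x ^+ 2)%:C.
  by rewrite conj_pair; simpc; congr (_ +i* _); ring.
have nz : (1 +i* x)^*%R != 0.
  apply: contraTneq d0 => z0; have := n0; rewrite z0 mul0r => -[<-].
  by rewrite ltxx.
apply: (mulIf nz); rewrite divfK// mulr_natl mulr2n expiD expi_atan.
set k := _^-1%:C; have kk : k * k * (1 + x ^+ 2)%:C = 1.
  rewrite -!rmorphM /= -expr2 exprVn sqr_sqrtr ?ltW// mulVf ?gt_eqF//.
transitivity (k * k * ((1 +i* x)^*%R * (1 +i* x)) * (1 +i* x)); first by ring.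
by rewrite n0 kk mul1r.
Qed.

Lemma expi_mobius_liftE a b : disk a ->
  expi (mobius_lift a b) = expi b * (lift_den a b / (lift_den a b)^*%R).
Proof.
move=> da; rewrite /mobius_lift expiD expi_double_atan.
have p0 := Re_lift_den_gt0 b da.
set q := lift_den a b in p0 *.
have -> : 1 +i* (Im q / Re q) = (Re q)^-1%:C * q.
  by case: q p0 => p r /= p0; rewrite realM_complex mulVf ?gt_eqF// mulrC.
have pc : ((Re q)^-1%:C)^*%R = (Re q)^-1%:C by exact: conjc_real.
have pc0 : (Re q)^-1%:C != 0 by rewrite fmorph_eq0 invr_eq0 gt_eqF.
by rewrite rmorphM /= pc -mulf_div divff// mul1r.
Qed.

Lemma expi_mobius_lift a psi x : disk a ->
  expi (mobius_lift a (psi + x)) = mobius a psi (expi x).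
Proof.
move=> da; rewrite expi_mobius_liftE// lift_denE rmorphD rmorph1 rmorphM /= conjCK.
rewrite /mobius -[a^*%R * _ * _]mulrA -expiD mulrA; congr (_ / _).
by rewrite mulrDr mulr1 mulrCA expi_conj mulr1 addrC.
Qed.

(** Translates the real form in which the derivative of twice an arctangent appears into the complex
    form of [lift_identity]. *)
Lemma double_Re_div w q : q != 0 ->
  (2 * ((Re w * Re q + Im w * Im q) / (Re q ^+ 2 + Im q ^+ 2)))%:C =
  w / q + w^*%R / q^*%R.
Proof.
case: w q => [w1 w2] [p r] q0 /=.
have n0 : p ^+ 2 + r ^+ 2 != 0.
  apply: contra q0; rewrite paddr_eq0 ?sqr_ge0// !sqrf_eq0 => /andP[/eqP -> /eqP ->].
  by [].
have nC : (p ^+ 2 + r ^+ 2)%:C != 0 by rewrite fmorph_eq0.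
have q0' : p -i* r != 0.
  by move: q0; rewrite !eq_complex /= oppr_eq0.
have nE : (p +i* r) * (p -i* r) = (p ^+ 2 + r ^+ 2)%:C.
  by simpc; congr (_ +i* _); ring.
have -> : (2 * ((w1 * p + w2 * r) / (p ^+ 2 + r ^+ 2)))%:C =
    (2 * (w1 * p + w2 * r))%:C / (p ^+ 2 + r ^+ 2)%:C.
  by rewrite mulrA rmorphM fmorphV.
rewrite !conj_pair -nE.
have -> : (2 * (w1 * p + w2 * r))%:C =
    (w1 +i* w2) * (p -i* r) + (w1 -i* w2) * (p +i* r).
  by simpc; congr (_ +i* _); ring.
move: (w1 +i* w2) (w1 -i* w2) (p +i* r) (p -i* r) q0 q0' => w w' q q' q0 q0'.
by rewrite /=; field; rewrite q0 q0'.
Qed.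

(* [E] stands for [expi b] and primes for complex conjugates, the conjugate of [E]
   being its inverse. *)
Lemma lift_identity (K : fieldType) (E a a' F F' G : K) :
  E != 0 -> 1 + a / E != 0 -> 1 + a' * E != 0 ->
  let d := F * a + G + F' * a' in
  let q := 1 + a / E in let q' := 1 + a' * E in
  d + ((F * a ^+ 2 + G * a + F' - a * d) / E / q +
       (F' * a' ^+ 2 + G * a' + F - a' * d) * E / q') =
  F * (E * q / q') + G + F' * (q' / (E * q)).
Proof.
move=> E0 q0 q0' d q q'; rewrite /d /q /q'; field.
have Ea : E + a = E * (1 + a / E) by rewrite mulrDr mulr1 mulrCA mulfV ?mulr1.
by rewrite E0 q0' Ea mulf_neq0.
Qed.

(** Here [F] and [G] stand for the values of [f] and [g] at the current order parameter; the
    conclusion is then the phase equation. *)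
Lemma is_derive_mobius_lift (a : R -> R[i]) (psi : R -> R) (x t d G : R) F :
  disk (a t) ->
  is_derivec a t ('i%C * (F * a t ^+ 2 + G%:C * a t + F^*%R)) ->
  is_derive t 1 psi d -> d%:C = F * a t + G%:C + F^*%R * (a t)^*%R ->
  let phi := fun s => mobius_lift (a s) (psi s + x) in
  is_derive t 1 phi (2 * (Re F * cos (phi t) - Im F * sin (phi t)) + G).
Proof.
move=> da [dx dy] dpsi dE phi.
set b := psi t + x; set E := expi b.
have db : is_derive t 1 (fun s => psi s + x) d.
  by have := is_deriveD dpsi (is_derive_cst x t (1 : R)); rewrite addr0.
pose c s := cos (psi s + x); pose sn s := sin (psi s + x).
have dc : is_derive t 1 c (- sin b * d) :=
  @is_derive1_comp _ cos (fun s => psi s + x) t _ _ (is_derive_cos b) db.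
have ds : is_derive t 1 sn (cos b * d) :=
  @is_derive1_comp _ sin (fun s => psi s + x) t _ _ (is_derive_sin b) db.
set A := F * a t ^+ 2 + G%:C * a t + F^*%R in dx dy.
have ReiA : Re ('i%C * A) = - Im A by rewrite mulrC ReiNIm.
have ImiA : Im ('i%C * A) = Re A by rewrite mulrC ImiRe.
rewrite ReiA in dx; rewrite ImiA in dy.
(* Chosen so that [lift_den (a s) (psi s + x)], called [q] below, has derivative ['i * W]; its
   argument then has derivative the real part of [W / q]. *)
pose W := (A - a t * d%:C) * E^*%R.
pose p s := Re (lift_den (a s) (psi s + x)).
pose r s := Im (lift_den (a s) (psi s + x)).
have WE : W = (((Re A - Re (a t) * d) * cos b + (Im A - Im (a t) * d) * sin b) +i*
   ((Im A - Im (a t) * d) * cos b - (Re A - Re (a t) * d) * sin b)).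
  rewrite /W /E /expi; move: (A) (a t) => [A1 A2] [a1 a2].
  by rewrite conj_pair /=; simpc; congr (_ +i* _); ring.
have dp : is_derive t 1 p (- Im W).
  have H := is_deriveD (is_deriveD (is_derive_cst (1 : R) t (1 : R))
     (is_deriveM dx dc)) (is_deriveM dy ds).
  apply: is_derive_eq H _.
  by rewrite WE /= /GRing.scale /= /c /sn; ring.
have dr : is_derive t 1 r (Re W).
  have H := is_deriveB (is_deriveM dy dc) (is_deriveM dx ds).
  apply: is_derive_eq H _.
  by rewrite WE /= /GRing.scale /= /c /sn -/b; ring.
have p0 : 0 < p t := Re_lift_den_gt0 _ da.
have p0' : p t != 0 by rewrite gt_eqF.
have pr0 : p t ^+ 2 + r t ^+ 2 != 0.
  by rewrite gt_eqF// ltr_pwDl ?exprn_gt0 ?sqr_ge0.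
have dphi : is_derive t 1 phi
    (d + 2 * ((Re W * p t + Im W * r t) / (p t ^+ 2 + r t ^+ 2))).
  have dV := is_deriveV p0' dp.
  have dat := is_derive1_comp (is_derive1_atan _) (is_deriveM dr dV).
  have H := is_deriveD db (is_deriveZ 2 dat).
  apply: is_derive_eq H _.
  rewrite /= /GRing.scale /= -[X in (1 + X ^+ 2)^-1]/(r t / p t).
  congr (_ + 2 * _).
  have n0 : 1 + (r t / p t) ^+ 2 != 0.
    by rewrite gt_eqF// ltr_pwDl ?sqr_ge0.
  move: n0 pr0 p0'; rewrite /r /p; move: (Im (lift_den _ _)) (Re (lift_den _ _)).
  move: (Re W) (Im W) => w1 w2 v u n0 pr0 u0.
  by field; rewrite u0 pr0.
apply: is_derive_eq dphi _; apply/phase_rhsE.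
have E0 : E != 0 := expi_neq0 b.
have Ec : E^*%R = E^-1 by apply: (mulfI E0); rewrite expi_conj mulfV.
set q := lift_den (a t) b.
have q0 : q != 0 by rewrite eq_complex negb_and (gt_eqF p0).
have qE : q = 1 + a t / E by rewrite /q lift_denE -/E Ec.
have qcE : q^*%R = 1 + (a t)^*%R * E.
  by rewrite /q lift_denE rmorphD rmorph1 rmorphM /= conjCK.
have qc0 : q^*%R != 0 by rewrite conjC_eq0.
have phiE : expi (phi t) = E * q / q^*%R.
  by rewrite expi_mobius_liftE// mulrA.
have phicE : (expi (phi t))^*%R = q^*%R / (E * q).
  by rewrite phiE !rmorphM fmorphV /= conjCK Ec; field; rewrite E0 q0.
rewrite expiN phicE phiE.
have -> : (d + 2 * ((Re W * p t + Im W * r t) / (p t ^+ 2 + r t ^+ 2)))%:C =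
    d%:C + (W / q + W^*%R / q^*%R) by rewrite -double_Re_div// -rmorphD.
have realC (v : R) : (v%:C)^*%R = v%:C by exact: conjc_real.
have WcE : W^*%R =
    (F^*%R * (a t)^*%R ^+ 2 + G%:C * (a t)^*%R + F - (a t)^*%R * d%:C) * E.
  by rewrite /W /A rmorphM rmorphB !rmorphD !rmorphM /= !realC !conjCK.
rewrite WcE /W Ec dE qcE qE; apply: lift_identity; rewrite -?qE -?qcE//.
Qed.

End MobiusLift.

(** * Symmetries of the phase equations and the lifted periodic solution *)

Section SplayState.
Variables (R : realType) (n : nat) (f : R[i] -> R[i]) (g : R[i] -> R).
Local Notation N := n.+4.
Local Notation lams := (lambda_star R n).

Lemma Zphase_rotate (k : 'I_N) (x : 'rV[R]_N) : Zphase (rotate k x) = Zphase x.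
Proof.
rewrite /Zphase [in RHS](reindex_inj (addIr k)); congr (_ * _).
by apply: eq_bigr => j _; rewrite mxE.
Qed.

Lemma phase_solution_rotate (k : 'I_N) (phi : R -> 'rV[R]_N) :
  phase_solution f g phi -> phase_solution f g (fun t => rotate k (phi t)).
Proof.
move=> /phase_solutionP dphi; apply/phase_solutionP => t j.
have := dphi t (j + k)%R; rewrite /phase_rhs Zphase_rotate mxE.
by congr is_derive; apply/funext => s; rewrite mxE.
Qed.

Lemma phase_solution_shift (c : R) (phi : R -> 'rV[R]_N) :
  phase_solution f g phi -> phase_solution f g (fun t => phi (t + c)).
Proof.
move=> /phase_solutionP dphi; apply/phase_solutionP => t j.
have dshift : is_derive t 1 (fun s : R => s + c) 1.
  by have := is_deriveD (is_derive_id t (1 : R)) (is_derive_cst c t (1 : R)); rewrite addr0.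
have := @is_derive1_comp _ (fun s => phi s 0 j) _ t _ _ (dphi (t + c) j) dshift.
by rewrite mulr1.
Qed.

Definition lift_solution (alpha : R -> R[i]) (psi : R -> R) (t : R) : 'rV[R]_N :=
  \row_j mobius_lift (alpha t) (psi t + Theta lams 0 j).

Lemma coordinates_Zphase (a : R[i]) (psi : R) lam (phi : 'rV[R]_N) :
  coordinates a psi lam phi -> Zphase phi = Zcoord a psi lam.
Proof. by move=> co; rewrite /Zphase /Zcoord; under eq_bigr do rewrite co. Qed.

Lemma coordinates_eqT (a : R[i]) (psi psi' : R) lam (x y : 'rV[R]_N) :
  eq2pi psi psi' -> coordinates a psi lam x -> coordinates a psi' lam y -> eqT x y.
Proof.
by move=> /expi_eq2pi e cx cy; apply/eqTE => j; rewrite cx cy /mobius e.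
Qed.

Variables (alpha : R -> R[i]) (psi : R -> R).
Hypothesis hsol : reduced_solution f g setT alpha psi (fun=> lams).

Lemma lift_solution_coordinates t :
  coordinates (alpha t) (psi t) lams (lift_solution alpha psi t).
Proof.
by have [[da _] _ _ _] := @hsol t I; move=> j; rewrite mxE expi_mobius_lift.
Qed.

(** The order parameter is the same in phases and in coordinates, so [is_derive_mobius_lift] applies
    with [f] and [g] evaluated there. *)
Lemma lift_solution_phase : phase_solution f g (lift_solution alpha psi).
Proof.
apply/phase_solutionP => t j; have [[da _] a' [d psi' dE] _] := @hsol t I.
rewrite -complexiE in a'.
have liftE s : lift_solution alpha psi s 0 j =
    mobius_lift (alpha s) (psi s + Theta lams 0 j) by rewrite mxE.
rewrite /phase_rhs (coordinates_Zphase (lift_solution_coordinates t)) liftE.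
rewrite (funext liftE); exact: is_derive_mobius_lift da a' psi' dE.
Qed.

End SplayState.

(** * From the rotation-invariant orbit to the splay state *)

Unset Implicit Arguments.

Theorem proposition4p13 (R : realType) (f : R[i] -> R[i]) (g : R[i] -> R)
    (alpha0 : R[i])
    (hf : smooth_on_diskc f) (hg : smooth_on_disk g)
    (halpha0 : unique (stable_fixed_point f g) alpha0)
    (hf0 : f alpha0 <> 0)
    (n : nat) (delta : R) (C : 'rV[R]_n.+1 -> set 'rV[R]_n.+4)
    (hC : continuum f g delta C)
    (T : R) (alpha : R -> R[i]) (psi : R -> R)
    (hT : 0 < T)
    (hsol : reduced_solution f g setT alpha psi (fun=> lambda_star R n))
    (hper : forall t, alpha (t + T) = alpha t /\ eq2pi (psi (t + T)) (psi t))
    (horb : C (lambda_star R n) =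
      [set theta | exists t, coordinates (alpha t) (psi t) (lambda_star R n) theta]) :
  exists2 phi : R -> 'rV[R]_n.+4,
    forall t, coordinates (alpha t) (psi t) (lambda_star R n) (phi t) &
    splay_state f g phi.
Proof.
pose phi := lift_solution n alpha psi; have co := lift_solution_coordinates hsol.
have sol : phase_solution f g phi := lift_solution_phase hsol.
have [[_ Vl] _ _ _] := hsol 0 I.
exists phi => //; split => //.
have Vbarl : Vbar delta (lambda_star R n).
  split => //; have [delta0 _ _ _] := hC; rewrite subrr /enorm big1 ?sqrtr0 ?ltW//.
  by move=> j _; rewrite mxE expr0n.
have [stab uniqC] : unique (stable_orbit_in_level f g (lambda_star R n))
    (C (lambda_star R n)) by case: hC => _ + _ _; apply.
have Cphi t : C (lambda_star R n) (phi t) by rewrite horb; exists t.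
have ophi t : ordered (phi t) by have [_ + _] := stab => /(_ _ (Cphi t))[].
have [tau0 co0] : exists t,
    coordinates (alpha t) (psi t) (lambda_star R n) (rotate 1 (phi 0)).
  have : C (lambda_star R n) (rotate 1 (phi 0)).
    by rewrite (uniqC _ (stable_orbit_rotate Vl 1 stab)); exists (phi 0).
  by rewrite horb.
have per t : eqT (phi (t + T)) (phi t).
  have [aE pE] := hper t; apply: coordinates_eqT pE _ (co t).
  by rewrite -aE.
have perM m t : eqT (phi (t + T *+ m)) (phi t).
  elim: m => [|m IH]; first by apply/eqTE => j; rewrite addr0.
  apply/eqTE => j; rewrite mulrSr addrA.
  by have /eqTE -> := per (t + T *+ m); have /eqTE -> := IH.
(* Uniqueness was proved forward in time, so times are made positive by adding periods: once to
   define [tau], once to extend the shift relation to all [t]. *)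
have shiftT (s : R) : exists m, 0 < s + T *+ m.
  exists (Num.bound `|- s / T|); rewrite -mulr_natl addrC -ltrBlDr sub0r -ltr_pdivrMr//.
  exact: le_lt_trans (ler_norm _) (archi_boundP (normr_ge0 _)).
have [m m0] := shiftT tau0.
set tau := tau0 + T *+ m in m0.
have start : eqT (phi tau) (rotate 1 (phi 0)).
  apply/eqTE => j; have /eqTE -> := perM m tau0.
  by rewrite co co0.
have step_pos t : 0 <= t -> eqT (phi (t + tau)) (rotate 1 (phi t)).
  apply: (phase_solution_unique hf hg (phase_solution_shift tau sol)
    (phase_solution_rotate 1 sol)) => [s|s|]; first exact: ophi.
    exact/ordered_rotate/ophi.
  by rewrite add0r.
have step t j : expi (phi (t + tau) 0 j) = expi (phi t 0 (j + 1)%R).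
  have [k /ltW k0] := shiftT t.
  have /eqTE <- := perM k (t + tau); rewrite addrAC.
  have /eqTE -> := step_pos _ k0; rewrite mxE.
  by have /eqTE -> := perM k t.
have iterate k t j : expi (phi (t + tau *+ k) 0 j) =
    expi (phi t 0 (inord ((j + k) %% n.+4))).
  elim: k t => [|k IH] t; first by rewrite addr0 addn0 modn_small// inord_val.
  rewrite mulrS addrA IH step; congr (expi (phi t 0 _)).
  by apply: val_inj; rewrite /= !inordK ?ltn_pmod// modnDm addn1 addnS.
have Ntau t j : expi (phi (t + tau *+ n.+4) 0 j) = expi (phi t 0 j).
  by rewrite iterate modnDr modn_small// inord_val.
exists (tau *+ n.+4); split.
- by rewrite pmulrn_lgt0.
- by move=> t; apply/eqTE => j; exact: Ntau.
(* The definition evaluates at [j.+1] steps for the 0-based index [j], while index [j] lags index 0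
   by only [j] steps; the delay [tau] absorbs the extra one. *)
- exists (fun t => phi (t - tau) 0 0).
    by move=> t; apply/eq2piE; rewrite addrAC Ntau.
  move=> t j; apply/eq2piE.
  have -> : t + j.+1%:R * (tau *+ n.+4) / n.+4%:R - tau = t + tau *+ j.
    rewrite -[tau *+ n.+4]mulr_natr mulrA mulfK ?pnatr_eq0//.
    rewrite -[tau *+ j]mulr_natr -natr1; ring.
  by rewrite iterate add0n modn_small// inord_val.
Qed.
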